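(* Let $\mathcal H$ be a separable right quaternionic Hilbert space equipped with a left scalar multiplication $q\mapsto L_q$, let $T=T^*\in\mathcal B(\mathcal H)$ with spectral measure $E$, and let $\Delta$ be an isolated part of $\sigma_S(T)$, with Riesz projection $P_\Delta$. Then $P_\Delta=E(\Delta)$. In particular, $P_\Delta$ is an orthogonal projection.
   Context: A right quaternionic Hilbert space $\mathcal H$ is a right $\mathbb H$-module with an $\mathbb H$-valued inner product that is right linear in the second argument, hermitian, positive definite, and complete for $\|x\|=\langle x,x\rangle^{1/2}$. $\mathcal B(\mathcal H)$ is the real unital Banach algebra of bounded right linear operators on $\mathcal H$, $T^*$ the adjoint, $\mathrm{Id}$ the identity. A left scalar multiplication is a fixed map $q\mapsto L_q\in\mathcal B(\mathcal H)$, $q\in\mathbb H$, with $L_qL_{q'}=L_{qq'}$ and $L_q^*=L_{\overline q}$, of the usual form $L_q(\sum_n e_nx_n)=\sum_n e_n\,qx_n$ for a Hilbert basis $(e_n)$ of $\mathcal H$. One writes $qx=L_qx$, and for $A\in\mathcal B(\mathcal H)$: $qA=L_qA$, $Aq=AL_q$, and $q\,\mathrm{Id}=L_q$. For $q\in\mathbb H$ put $Q_q(T)=T^2-2\operatorname{Re}(q)T+|q|^2\mathrm{Id}$ and $\sigma_S(T)=\{q\in\mathbb H: Q_q(T)\text{ is not invertible in }\mathcal B(\mathcal H)\}$. For self-adjoint $T$, $\sigma_S(T)\subset\mathbb R$. Let $\mathbb S=\{I\in\mathbb H: I^2=-1\}$ and $\mathbb C_I=\mathbb R+I\mathbb R$.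 A set $\Omega\subset\mathbb H$ is axially symmetric if $hqh^{-1}\in\Omega$ for all $q\in\Omega$, $h\in\mathbb H\setminus\{0\}$. An isolated part of $\sigma_S(T)$ is a nonempty axially symmetric subset $\Delta\subset\sigma_S(T)$ that is open and closed in $\sigma_S(T)$. Its Riesz projection is $$P_\Delta=\frac1{2\pi}\int_{\partial(U_\Delta\cap\mathbb C_I)}S_L^{-1}(s,T)\,ds_I,\qquad ds_I=-I\,ds,\qquad S_L^{-1}(s,T)=-Q_s(T)^{-1}(T-\overline s\,\mathrm{Id}),$$ where $I\in\mathbb S$ and $U_\Delta\subset\mathbb H$ is a bounded axially symmetric open set with $\Delta\subset U_\Delta$, $\overline{U_\Delta}\cap\sigma_S(T)=\Delta$, and such that for each $I\in\mathbb S$ the boundary $\partial(U_\Delta\cap\mathbb C_I)$ is a finite union of positively oriented rectifiable Jordan curves. It is known that $P_\Delta$ is an idempotent in $\mathcal B(\mathcal H)$ commuting with $T$, independent of $U_\Delta$ and $I$. The spectral measure of $T=T^*$ is the unique projection-valued measure $E$ on the Borel sets of $\mathbb R$ (values orthogonal projections in $\mathcal B(\mathcal H)$, $E(\mathbb R)=\mathrm{Id}$, $E(B_1\cap B_2)=E(B_1)E(B_2)$, strongly countably additive) with $T=\int_{\mathbb R}t\,dE(t)$; it has support $\sigma_S(T)$ (existence and uniqueness are the known quaternionic spectral theorem). *)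

(* Defs.v *)
From HB Require Import structures.
From mathcomp Require Import all_boot all_order all_algebra.
From mathcomp Require Import ring lra.
From mathcomp Require Import all_classical all_reals all_analysis.
From mathcomp.analysis.showcase Require Import summability.

Set Implicit Arguments.
Unset Strict Implicit.
Unset Printing Implicit Defensive.

Import Order.TTheory GRing.Theory Num.Theory.
Import numFieldNormedType.Exports.

Local Open Scope classical_set_scope.
Local Open Scope ring_scope.

(* [Quat a b c d] is a + b i + c j + d k *)
Record quat (R : realType) := Quat { qre : R; qim1 : R; qim2 : R; qim3 : R }.

Section Quaternions.
Context {R : realType}.
Implicit Types x y z : quat R.

Definition quat_tuple x := (qre x, qim1 x, qim2 x, qim3 x).
Definition tuple_quat (u : R * R * R * R) :=
  Quat u.1.1.1 u.1.1.2 u.1.2 u.2.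
Lemma quat_tupleK : cancel quat_tuple tuple_quat. Proof. by case. Qed.

HB.instance Definition _ := Choice.copy (quat R) (can_type quat_tupleK).

Lemma quat_ext x y : qre x = qre y -> qim1 x = qim1 y ->
  qim2 x = qim2 y -> qim3 x = qim3 y -> x = y.
Proof. by case: x y => [a b c d] [a' b' c' d'] /= -> -> -> ->. Qed.

Definition qzero : quat R := Quat 0 0 0 0.
Definition qone : quat R := Quat 1 0 0 0.
Definition qopp x := Quat (- qre x) (- qim1 x) (- qim2 x) (- qim3 x).
Definition qadd x y :=
  Quat (qre x + qre y) (qim1 x + qim1 y) (qim2 x + qim2 y) (qim3 x + qim3 y).
Definition qmul x y := Quat
  (qre x * qre y - qim1 x * qim1 y - qim2 x * qim2 y - qim3 x * qim3 y)
  (qre x * qim1 y + qim1 x * qre y + qim2 x * qim3 y - qim3 x * qim2 y)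
  (qre x * qim2 y - qim1 x * qim3 y + qim2 x * qre y + qim3 x * qim1 y)
  (qre x * qim3 y + qim1 x * qim2 y - qim2 x * qim1 y + qim3 x * qre y).
Definition qscale (r : R) x :=
  Quat (r * qre x) (r * qim1 x) (r * qim2 x) (r * qim3 x).
Definition qconj x := Quat (qre x) (- qim1 x) (- qim2 x) (- qim3 x).
Definition qsqnorm x := qre x ^+ 2 + qim1 x ^+ 2 + qim2 x ^+ 2 + qim3 x ^+ 2.
Definition qinv x := qscale (qsqnorm x)^-1 (qconj x).

Fact qaddA : associative qadd.
Proof. by move=> x y z; apply: quat_ext => /=; ring. Qed.
Fact qaddC : commutative qadd.
Proof. by move=> x y; apply: quat_ext => /=; ring. Qed.
Fact qadd0 : left_id qzero qadd.
Proof. by move=> x; apply: quat_ext => /=; ring. Qed.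
Fact qaddN : left_inverse qzero qopp qadd.
Proof. by move=> x; apply: quat_ext => /=; ring. Qed.
HB.instance Definition _ :=
  GRing.isZmodule.Build (quat R) qaddA qaddC qadd0 qaddN.

Fact qmulA : associative qmul.
Proof. by move=> x y z; apply: quat_ext => /=; ring. Qed.
Fact qmul1x : left_id qone qmul.
Proof. by move=> x; apply: quat_ext => /=; ring. Qed.
Fact qmulx1 : right_id qone qmul.
Proof. by move=> x; apply: quat_ext => /=; ring. Qed.
Fact qmulDl : left_distributive qmul qadd.
Proof. by move=> x y z; apply: quat_ext => /=; ring. Qed.
Fact qmulDr : right_distributive qmul qadd.
Proof. by move=> x y z; apply: quat_ext => /=; ring. Qed.
Fact qone_neq0 : qone != 0 :> quat R.
Proof. by apply/eqP => -[] /eqP; rewrite oner_eq0. Qed.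
HB.instance Definition _ := GRing.Zmodule_isNzRing.Build (quat R)
  qmulA qmul1x qmulx1 qmulDl qmulDr qone_neq0.

Fact qscaleA a b x : qscale a (qscale b x) = qscale (a * b) x.
Proof. by apply: quat_ext => /=; ring. Qed.
Fact qscale1 : left_id 1 qscale.
Proof. by move=> x; apply: quat_ext => /=; ring. Qed.
Fact qscaleDr : right_distributive qscale +%R.
Proof. by move=> a x y; apply: quat_ext => /=; ring. Qed.
Fact qscaleDl x : {morph qscale^~ x : a b / a + b}.
Proof. by move=> a b; apply: quat_ext => /=; ring. Qed.
HB.instance Definition _ := GRing.Zmodule_isLmodule.Build R (quat R)
  qscaleA qscale1 qscaleDr qscaleDl.

Fact qscaleAl (a : R) x y : a *: (x * y) = (a *: x) * y.
Proof. by apply: quat_ext => /=; ring. Qed.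
HB.instance Definition _ := GRing.Lmodule_isLalgebra.Build R (quat R) qscaleAl.
Fact qscaleAr (a : R) x y : a *: (x * y) = x * (a *: y).
Proof. by apply: quat_ext => /=; ring. Qed.
HB.instance Definition _ := GRing.Lalgebra_isAlgebra.Build R (quat R) qscaleAr.

Lemma qsqnorm_ge0 x : 0 <= qsqnorm x.
Proof. by rewrite /qsqnorm !addr_ge0// sqr_ge0. Qed.

Lemma qsqnorm_eq0 x : (qsqnorm x == 0) = (x == 0).
Proof.
apply/eqP/eqP => [|->]; last by rewrite /qsqnorm /= !expr0n /=; ring.
move=> h; have := (sqr_ge0 (qre x), sqr_ge0 (qim1 x), sqr_ge0 (qim2 x),
  sqr_ge0 (qim3 x)); rewrite /qsqnorm in h => -[[[h0 h1] h2] h3].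
by apply: quat_ext; apply/eqP; rewrite -sqrf_eq0 eq_le; apply/andP; split;
  rewrite //=; lra.
Qed.

Fact qmulVx : {in [pred x | x != 0], left_inverse 1 qinv *%R}.
Proof.
move=> x; rewrite inE -qsqnorm_eq0 => x0.
by apply: quat_ext => /=; rewrite /qsqnorm in x0 *; field.
Qed.
Fact qmulxV : {in [pred x | x != 0], right_inverse 1 qinv *%R}.
Proof.
move=> x; rewrite inE -qsqnorm_eq0 => x0.
by apply: quat_ext => /=; rewrite /qsqnorm in x0 *; field.
Qed.
Fact qunitP x y : y * x = 1 /\ x * y = 1 -> [pred x | x != 0] x.
Proof.
by move=> [yx _]; apply/eqP => x0; move/eqP: yx; rewrite x0 mulr0 eq_sym oner_eq0.
Qed.
Fact qinv_out : {in [predC [pred x | x != 0]], qinv =1 id}.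
Proof.
move=> x; rewrite !inE negbK => /eqP ->.
by apply: quat_ext => /=; ring.
Qed.
HB.instance Definition _ := GRing.NzRing_hasMulInverse.Build (quat R)
  qmulVx qmulxV qunitP qinv_out.

Definition qnorm x := Num.sqrt (qsqnorm x).

Fact qnormD x y : qnorm (x + y) <= qnorm x + qnorm y.
Proof.
have nx := qsqnorm_ge0 x; have ny := qsqnorm_ge0 y.
rewrite /qnorm -[leRHS]ger0_norm ?addr_ge0 ?sqrtr_ge0// -sqrtr_sqr ler_wsqrtr//.
rewrite sqrrD !sqr_sqrtr// -sqrtrM//.
pose d := qre x * qre y + qim1 x * qim1 y + qim2 x * qim2 y + qim3 x * qim3 y.
have -> : qsqnorm (x + y) = qsqnorm x + d *+ 2 + qsqnorm y.
  by rewrite /qsqnorm /d /=; ring.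
rewrite lerD2r lerD2l lerMn2r /= (le_trans (ler_norm d))// -sqrtr_sqr.
rewrite ler_wsqrtr// -subr_ge0.
have -> : qsqnorm x * qsqnorm y - d ^+ 2 =
  (qre x * qim1 y - qim1 x * qre y) ^+ 2 + (qre x * qim2 y - qim2 x * qre y) ^+ 2
  + (qre x * qim3 y - qim3 x * qre y) ^+ 2
  + (qim1 x * qim2 y - qim2 x * qim1 y) ^+ 2
  + (qim1 x * qim3 y - qim3 x * qim1 y) ^+ 2
  + (qim2 x * qim3 y - qim3 x * qim2 y) ^+ 2.
  by rewrite /qsqnorm /d; ring.
by rewrite !addr_ge0// sqr_ge0.
Qed.
Fact qnormZ (a : R) x : qnorm (a *: x) = `|a| * qnorm x.
Proof.
rewrite /qnorm -sqrtr_sqr -sqrtrM ?sqr_ge0//; congr Num.sqrt.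
by rewrite /qsqnorm /=; ring.
Qed.
Fact qnorm0_eq0 x : qnorm x = 0 -> x = 0.
Proof.
move=> /eqP; rewrite sqrtr_eq0 => h; apply/eqP.
by rewrite -qsqnorm_eq0 eq_le h qsqnorm_ge0.
Qed.
HB.instance Definition _ :=
  Lmodule_isNormed.Build R (quat R) qnormD qnormZ qnorm0_eq0.

Definition axially_symmetric (A : set (quat R)) :=
  forall q h, A q -> h != 0 -> A (h * q * h^-1).

Definition imag_unit (I : quat R) := I ^+ 2 = -1.

Definition slice (I : quat R) : set (quat R) :=
  [set q | exists u v : R, q = u%:A + v *: I].

(* The boundary is taken in the plane [slice I], which is closed in [quat R]. *)
Definition slice_boundary (I : quat R) (U : set (quat R)) :=
  closure (U `&` slice I) `&` closure (slice I `\` U).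

End Quaternions.

Section LineIntegral.
Context {R : realType}.

Definition subdivision n (t : nat -> R) :=
  [/\ t 0%N = 0, t n = 1 & forall k, (k < n)%N -> t k <= t k.+1].

Definition tagged_subdivision (d : R) n (t tag : nat -> R) :=
  subdivision n t /\
  forall k, (k < n)%N -> t k <= tag k <= t k.+1 /\ t k.+1 - t k < d.

Definition rectifiable (g : R -> quat R) :=
  exists M : R, forall n t, subdivision n t ->
    \sum_(k < n) `|g (t k.+1) - g (t k)| <= M.

Definition jordan_curve (g : R -> quat R) :=
  [/\ {within `[0, 1], continuous g}, g 0 = g 1 &
      {in `[0, 1[ &, injective g}].

(* [v] is the Riemann-Stieltjes integral along [g] of the form [f s ds],
   where [f s] is applied to the increments [ds] of the curve. *)
Definition is_line_integral (V : normedModType R) (g : R -> quat R)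
    (f : quat R -> quat R -> V) (v : V) :=
  forall e : R, 0 < e -> exists2 d : R, 0 < d &
    forall n t tag, tagged_subdivision d n t tag ->
      `|\sum_(k < n) f (g (tag k)) (g (t k.+1) - g (t k)) - v| < e.

(* 0 when the Riemann-Stieltjes sums diverge *)
Definition line_integral (V : normedModType R) (g : R -> quat R)
    (f : quat R -> quat R -> V) : V := xget 0 [set v | is_line_integral g f v].

Definition cycle_integral (V : normedModType R) n (G : 'I_n -> R -> quat R)
    (f : quat R -> quat R -> V) : V := \sum_(i < n) line_integral (G i) f.

Definition winding (I : quat R) n (G : 'I_n -> R -> quat R) (z : quat R) :
    quat R :=
  (2 * pi)^-1 *: cycle_integral G (fun s ds => (s - z)^-1 * (- I * ds)).

(* The curves [G] parametrize the boundary of [U] in [slice I]; they are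
   positively oriented with respect to [U], i.e. outer curves are run
   counterclockwise and the curves around holes clockwise (the plane being
   oriented by [(1, I)]): the winding number is 1 in [U] and 0 outside. *)
Definition positively_oriented_boundary (I : quat R) (U : set (quat R))
    n (G : 'I_n -> R -> quat R) :=
  [/\ forall i, jordan_curve (G i) /\ rectifiable (G i),
      slice_boundary I U = \bigcup_(i in [set: 'I_n]) (G i @` `[0, 1]),
      forall z, (U `&` slice I) z -> winding I G z = 1 &
      forall z, (slice I `\` closure (U `&` slice I)) z -> winding I G z = 0].

End LineIntegral.

(* The underlying real Banach space is part of the structure; its scalar
   multiplication is the restriction of the right quaternionic one, and its
   norm is the one defined by the inner product. *)
HB.mixin Record isQHilbert (R : realType) H & CompleteNormedModule R H := {
  rscale : H -> quat R -> H;
  rscaleDl : forall x y q, rscale (x + y) q = rscale x q + rscale y q;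
  rscaleDr : forall x p q, rscale x (p + q) = rscale x p + rscale x q;
  rscaleA : forall x p q, rscale (rscale x p) q = rscale x (p * q);
  rscale1 : forall x, rscale x 1 = x;
  rscale_real : forall x (r : R), rscale x r%:A = r *: x;
  qdot : H -> H -> quat R;
  qdotDr : forall x y z, qdot x (y + z) = qdot x y + qdot x z;
  qdotZr : forall x y q, qdot x (rscale y q) = qdot x y * q;
  qdotC : forall x y, qdot y x = qconj (qdot x y);
  qdot_gt0 : forall x, x != 0 -> 0 < qre (qdot x x);
  normE : forall x, `|x| = Num.sqrt (qre (qdot x x)) }.

#[short(type="qhilbertType")]
HB.structure Definition QHilbert (R : realType) :=
  {H of isQHilbert R H & CompleteNormedModule R H}.

Notation "x ** q" := (rscale x q) (at level 40, left associativity) : ring_scope.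

Definition separable (T : topologicalType) :=
  exists2 D : set T, countable D & dense D.

Section HilbertTheory.
Context {R : realType} {H : qhilbertType R}.
Implicit Types x y z : H.

Lemma rscaleZl (r : R) x q : (r *: x) ** q = r *: (x ** q).
Proof. by rewrite -!rscale_real !rscaleA -scalerAl mul1r -scalerAr mulr1. Qed.

Lemma qdotDl x y z : qdot (x + y) z = qdot x z + qdot y z.
Proof.
rewrite qdotC qdotDr (qdotC x z) (qdotC y z).
by case: (qdot z x) (qdot z y) => ? ? ? ? [? ? ? ?]; apply: quat_ext => /=; ring.
Qed.

Lemma qdot0r x : qdot x 0 = 0.
Proof. by apply: (addrI (qdot x 0)); rewrite -qdotDr !addr0. Qed.

Lemma sqr_normE x : `|x| ^+ 2 = qre (qdot x x).
Proof.
rewrite normE sqr_sqrtr//; have [->|/qdot_gt0/ltW//] := eqVneq x 0.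
by rewrite qdot0r.
Qed.

Lemma qre_qdotC x y : qre (qdot x y) = qre (qdot y x).
Proof. by rewrite qdotC. Qed.

Lemma qre_qdotE x y :
  qre (qdot x y) = (`|x + y| ^+ 2 - `|x| ^+ 2 - `|y| ^+ 2) / 2.
Proof.
by rewrite !sqr_normE qdotDl !qdotDr /= (qre_qdotC y x); lra.
Qed.

Lemma cvg_qre_qdot (x : H) (u : nat -> H) (l : H) :
  u @ \oo --> l -> qre (qdot x (u n)) @[n --> \oo] --> qre (qdot x l).
Proof.
move=> ul; under eq_fun do rewrite qre_qdotE; rewrite qre_qdotE.
by apply: cvgMl; apply: cvgB; [apply: cvgB|]; try exact: cvg_cst;
  rewrite expr2; under eq_fun do rewrite expr2; apply: cvgM; apply: cvg_norm => //;
  apply: cvgD => //; exact: cvg_cst.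
Qed.

Definition hilbert_basis (I : choiceType) (e : I -> H) :=
  (forall i j, qdot (e i) (e j) = (i == j)%:R) /\
  (forall x, partial_sum (fun i => e i ** qdot (e i) x) @ totally --> x).

End HilbertTheory.

Section RightLinear.
Context {R : realType} {H : qhilbertType R}.

Definition right_linear (f : H -> H) :=
  (forall x y, f (x + y) = f x + f y) /\ (forall x q, f (x ** q) = f x ** q).

Definition bounded_op (f : H -> H) := exists M : R, forall x, `|f x| <= M * `|x|.

End RightLinear.

Record bop (R : realType) (H : qhilbertType R) := Bop {
  bop_fun :> H -> H;
  bop_linear : right_linear bop_fun;
  bop_bounded : bounded_op bop_fun }.

HB.instance Definition _ (R : realType) (H : qhilbertType R) :=
  gen_eqMixin (bop H).
HB.instance Definition _ (R : realType) (H : qhilbertType R) :=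
  gen_choiceMixin (bop H).

Section BoundedOperators.
Context {R : realType} {H : qhilbertType R}.
Implicit Types A B C : bop H.

Lemma bop_ext A B : (forall x, A x = B x) -> A = B.
Proof.
case: A B => [f fl fb] [g gl gb] /= /funext fg; case: _ / fg in gl gb *.
by congr Bop; exact: Prop_irrelevance.
Qed.

Lemma bopD A x y : A (x + y) = A x + A y.
Proof. by case: A => f [? ?] ? /=. Qed.
Lemma bopZr A x q : A (x ** q) = A x ** q.
Proof. by case: A => f [? ?] ? /=. Qed.
Lemma bopZ A (r : R) x : A (r *: x) = r *: A x.
Proof. by rewrite -!rscale_real bopZr. Qed.

Lemma bop_boundedP A : exists2 M, 0 <= M & forall x, `|A x| <= M * `|x|.
Proof.
have [M hM] := bop_bounded A; exists `|M| => // x.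
by rewrite (le_trans (hM x))// ler_wpM2r// ler_norm.
Qed.

Fact bop0_linear : right_linear (fun _ : H => 0 : H).
Proof.
split=> [x y|x q]; first by rewrite addr0.
by apply: (addrI ((0 : H) ** q)); rewrite -rscaleDl !addr0.
Qed.
Fact bop0_bounded : bounded_op (fun _ : H => 0 : H).
Proof. by exists 0 => x; rewrite normr0 mul0r. Qed.
Definition bop0 := Bop bop0_linear bop0_bounded.

Fact bop1_linear : right_linear (fun x : H => x). Proof. by []. Qed.
Fact bop1_bounded : bounded_op (fun x : H => x).
Proof. by exists 1 => x; rewrite mul1r. Qed.
Definition bop1 := Bop bop1_linear bop1_bounded.

Fact bop_opp_linear A : right_linear (fun x => - A x).
Proof.
split=> [x y|x q]; first by rewrite bopD opprD.
by rewrite bopZr -scaleN1r -rscaleZl scaleN1r.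
Qed.
Fact bop_opp_bounded A : bounded_op (fun x => - A x).
Proof. by have [M hM] := bop_bounded A; exists M => x; rewrite normrN. Qed.
Definition bop_opp A := Bop (bop_opp_linear A) (bop_opp_bounded A).

Fact bop_add_linear A B : right_linear (fun x => A x + B x).
Proof.
by split=> [x y|x q]; rewrite ?bopD ?bopZr ?rscaleDl// addrACA.
Qed.
Fact bop_add_bounded A B : bounded_op (fun x => A x + B x).
Proof.
have [M hM] := bop_bounded A; have [N hN] := bop_bounded B.
by exists (M + N) => x; rewrite mulrDl (le_trans (ler_normD _ _))// lerD.
Qed.
Definition bop_add A B := Bop (bop_add_linear A B) (bop_add_bounded A B).

Fact bop_mul_linear A B : right_linear (fun x => A (B x)).
Proof. by split=> [x y|x q]; rewrite ?bopD ?bopZr. Qed.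
Fact bop_mul_bounded A B : bounded_op (fun x => A (B x)).
Proof.
have [M M0 hM] := bop_boundedP A; have [N N0 hN] := bop_boundedP B.
by exists (M * N) => x; rewrite -mulrA (le_trans (hM _))// ler_wpM2l.
Qed.
Definition bop_mul A B := Bop (bop_mul_linear A B) (bop_mul_bounded A B).

Fact bop_scale_linear (r : R) A : right_linear (fun x => r *: A x).
Proof. by split=> [x y|x q]; rewrite ?bopD ?bopZr ?scalerDr ?rscaleZl. Qed.
Fact bop_scale_bounded (r : R) A : bounded_op (fun x => r *: A x).
Proof.
have [M hM] := bop_bounded A; exists (`|r| * M) => x.
by rewrite normrZ -mulrA ler_wpM2l.
Qed.
Definition bop_scale r A := Bop (bop_scale_linear r A) (bop_scale_bounded r A).

Fact bop_addA : associative bop_add.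
Proof. by move=> A B C; apply: bop_ext => x /=; rewrite addrA. Qed.
Fact bop_addC : commutative bop_add.
Proof. by move=> A B; apply: bop_ext => x /=; rewrite addrC. Qed.
Fact bop_add0 : left_id bop0 bop_add.
Proof. by move=> A; apply: bop_ext => x /=; rewrite add0r. Qed.
Fact bop_addN : left_inverse bop0 bop_opp bop_add.
Proof. by move=> A; apply: bop_ext => x /=; rewrite addNr. Qed.
HB.instance Definition _ :=
  GRing.isZmodule.Build (bop H) bop_addA bop_addC bop_add0 bop_addN.

Fact bop_mulA : associative bop_mul.
Proof. by move=> A B C; apply: bop_ext. Qed.
Fact bop_mul1x : left_id bop1 bop_mul.
Proof. by move=> A; apply: bop_ext. Qed.
Fact bop_mulx1 : right_id bop1 bop_mul.
Proof. by move=> A; apply: bop_ext. Qed.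
Fact bop_mulDl : left_distributive bop_mul bop_add.
Proof. by move=> A B C; apply: bop_ext. Qed.
Fact bop_mulDr : right_distributive bop_mul bop_add.
Proof. by move=> A B C; apply: bop_ext => x /=; rewrite bopD. Qed.
HB.instance Definition _ := GRing.Zmodule_isPzRing.Build (bop H)
  bop_mulA bop_mul1x bop_mulx1 bop_mulDl bop_mulDr.

Fact bop_scaleA a b A : bop_scale a (bop_scale b A) = bop_scale (a * b) A.
Proof. by apply: bop_ext => x /=; rewrite scalerA. Qed.
Fact bop_scale1 : left_id 1 bop_scale.
Proof. by move=> A; apply: bop_ext => x /=; rewrite scale1r. Qed.
Fact bop_scaleDr : right_distributive bop_scale +%R.
Proof. by move=> a A B; apply: bop_ext => x /=; rewrite scalerDr. Qed.
Fact bop_scaleDl A : {morph bop_scale^~ A : a b / a + b}.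
Proof. by move=> a b; apply: bop_ext => x /=; rewrite scalerDl. Qed.
HB.instance Definition _ := GRing.Zmodule_isLmodule.Build R (bop H)
  bop_scaleA bop_scale1 bop_scaleDr bop_scaleDl.

Definition opnorm A : R := sup [set `|A x| | x in [set x | `|x| <= 1]].

Lemma bop_at0 A : A 0 = 0.
Proof. by apply: (addrI (A 0)); rewrite -bopD !addr0. Qed.

Lemma opnorm_has_sup A : has_sup [set `|A x| | x in [set x | `|x| <= 1]].
Proof.
split; first by exists `|A 0|; exists 0 => //=; rewrite normr0.
have [M M0 hM] := bop_boundedP A; exists M => _ [x /= x1 <-].
by rewrite (le_trans (hM x))// ler_piMr.
Qed.

Lemma opnorm_ub A x : `|A x| <= opnorm A * `|x|.
Proof.
have [->|x0] := eqVneq x 0; first by rewrite bop_at0 !normr0 mulr0.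
rewrite -ler_pdivrMr ?normr_gt0//.
have -> : `|A x| / `|x| = `|A (`|x|^-1 *: x)|.
  by rewrite bopZ normrZ normrV ?unitfE ?normr_eq0// normr_id mulrC.
apply: sup_upper_bound; first exact: opnorm_has_sup.
exists (`|x|^-1 *: x) => //=.
by rewrite normrZ normrV ?unitfE ?normr_eq0// normr_id mulVf// normr_eq0.
Qed.

Lemma opnorm_le A (M : R) : (forall x, `|x| <= 1 -> `|A x| <= M) -> opnorm A <= M.
Proof.
move=> h; apply: ge_sup; first by have [] := opnorm_has_sup A.
by move=> _ [x /= x1 <-]; exact: h.
Qed.

Lemma opnorm_ge0 A : 0 <= opnorm A.
Proof.
rewrite -(normr0 H) -{1}(bop_at0 A).
by apply: sup_upper_bound; [exact: opnorm_has_sup|exists 0; rewrite //= normr0].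
Qed.

Fact opnormD A B : opnorm (A + B) <= opnorm A + opnorm B.
Proof.
apply: opnorm_le => x x1; rewrite (le_trans (ler_normD _ _))// lerD//.
  by rewrite (le_trans (opnorm_ub A x))// ler_piMr// opnorm_ge0.
by rewrite (le_trans (opnorm_ub B x))// ler_piMr// opnorm_ge0.
Qed.
Fact opnormZ_le (a : R) A : opnorm (a *: A) <= `|a| * opnorm A.
Proof.
apply: opnorm_le => x x1; rewrite normrZ ler_wpM2l//.
by rewrite (le_trans (opnorm_ub A x))// ler_piMr// opnorm_ge0.
Qed.
Fact opnormZ (a : R) A : opnorm (a *: A) = `|a| * opnorm A.
Proof.
apply/eqP; rewrite eq_le opnormZ_le /=.
have [->|a0] := eqVneq a 0; first by rewrite normr0 mul0r opnorm_ge0.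
have := opnormZ_le a^-1 (a *: A).
by rewrite scalerA mulVf// scale1r normfV ler_pdivlMl ?normr_gt0.
Qed.
Fact opnorm0_eq0 A : opnorm A = 0 -> A = 0.
Proof.
move=> A0; apply: bop_ext => x; apply/eqP; rewrite -normr_le0.
by rewrite (le_trans (opnorm_ub A x))// A0 mul0r.
Qed.
HB.instance Definition _ :=
  Lmodule_isNormed.Build R (bop H) opnormD opnormZ opnorm0_eq0.

Definition is_adjoint A B := forall x y, qdot (A x) y = qdot x (B y).

Definition selfadjoint A := is_adjoint A A.

Definition orthogonal_projection A := A * A = A /\ selfadjoint A.

Definition is_inverse A B := A * B = 1 /\ B * A = 1.

Definition invertible A := exists B, is_inverse A B.

(* 0 when [A] is not invertible *)
Definition bop_inv A : bop H := xget 0 [set B | is_inverse A B].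

Definition left_scalar_mult (L : quat R -> bop H) :=
  [/\ forall p q, L p * L q = L (p * q),
      forall q, is_adjoint (L q) (L (qconj q)) &
      exists (I : choiceType) (e : I -> H), hilbert_basis e /\
        forall q (c : I -> quat R) x,
          partial_sum (fun i => e i ** c i) @ totally --> x ->
          partial_sum (fun i => e i ** (q * c i)) @ totally --> L q x].

Definition Qop (q : quat R) (T : bop H) : bop H :=
  T ^+ 2 - (2 * qre q) *: T + (`|q| ^+ 2) *: (1 : bop H).

Definition S_spectrum (T : bop H) : set (quat R) :=
  [set q | ~ invertible (Qop q T)].

Definition isolated_part (T : bop H) (D : set (quat R)) :=
  [/\ D !=set0, axially_symmetric D, D `<=` S_spectrum T,
      exists2 O, open O & D = O `&` S_spectrum T &
      exists2 C, closed C & D = C `&` S_spectrum T].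

Definition riesz_domain (T : bop H) (D U : set (quat R)) :=
  [/\ bounded_set U, axially_symmetric U /\ open U, D `<=` U,
      closure U `&` S_spectrum T = D &
      forall I, imag_unit I ->
        exists n (G : 'I_n -> R -> quat R), positively_oriented_boundary I U G].

Definition left_S_resolvent (L : quat R -> bop H) (s : quat R) (T : bop H) :
    bop H :=
  - (bop_inv (Qop s T) * (T - L (qconj s))).

(* A quaternion [q] acts on operators from the right as composition with [L q],
   hence [L (- I * ds)] for the form ds_I = - I ds. *)
Definition riesz_projection (L : quat R -> bop H) (T : bop H) (I : quat R)
    n (G : 'I_n -> R -> quat R) : bop H :=
  (2 * pi)^-1 *:
    cycle_integral G (fun s ds => left_S_resolvent L s T * L (- I * ds)).

End BoundedOperators.

Record pvm (R : realType) (H : qhilbertType R) := PVM {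
  pvm_fun :> set (measurableTypeR R) -> bop H;
  pvm_proj : forall B, measurable B -> orthogonal_projection (pvm_fun B);
  pvmT : pvm_fun setT = 1;
  pvmI : forall B1 B2, measurable B1 -> measurable B2 ->
    pvm_fun (B1 `&` B2) = pvm_fun B1 * pvm_fun B2;
  pvm_sigma_additive : forall F : nat -> set (measurableTypeR R),
    (forall n, measurable (F n)) -> trivIset setT F -> forall x,
    \sum_(0 <= i < n) pvm_fun (F i) x @[n --> \oo] -->
      pvm_fun (\bigcup_n F n) x }.

(* The scalar measure ||E(B) x||^2 = <x, E(B) x>. *)
Definition spectral_dist (R : realType) (H : qhilbertType R) (E : pvm H)
    (x : H) (B : set (measurableTypeR R)) : \bar R := (`|E B x| ^+ 2)%:E.

Section SpectralDist.
Context {R : realType} {H : qhilbertType R} (E : pvm H) (x : H).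

Lemma pvm0 : E set0 x = 0.
Proof.
have t0 : trivIset setT (fun _ : nat => set0 : set (measurableTypeR R)).
  by move=> i j _ _ [y []].
have h := @pvm_sigma_additive _ _ E (fun=> set0) (fun=> measurable0) t0 x.
have /cvg_series_cvg_0 : cvgn (series (fun _ : nat => E set0 x)).
  by apply/cvg_ex; exists (E (\bigcup_(n in [set: nat]) set0) x).
move=> h0; have h1 : (fun _ : nat => E set0 x) @ \oo --> E set0 x by exact: cvg_cst.
exact: (norm_cvg_unique h1 h0).
Qed.

Lemma pvm_qdot B : measurable B -> `|E B x| ^+ 2 = qre (qdot x (E B x)).
Proof.
move=> mB; have [EE sE] := pvm_proj E mB.
by rewrite sqr_normE sE -[in RHS]EE.
Qed.

Fact dist0 : spectral_dist E x set0 = 0%E.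
Proof. by rewrite /spectral_dist pvm0 normr0 expr0n. Qed.

Fact dist_ge0 B : (0 <= spectral_dist E x B)%E.
Proof. by rewrite lee_fin sqr_ge0. Qed.

Fact dist_sigma_additive : semi_sigma_additive (spectral_dist E x).
Proof.
move=> F mF tF mUF; have h := @pvm_sigma_additive _ _ E F mF tF x.
rewrite /spectral_dist (pvm_qdot mUF).
have -> : (fun n => \sum_(0 <= i < n) (`|E (F i) x| ^+ 2)%:E)%E =
    EFin \o (fun n => qre (qdot x (\sum_(0 <= i < n) E (F i) x))).
  apply/funext => n /=; rewrite sumEFin; congr EFin.
  elim: n => [|n IHn].
    by rewrite !big_nil qdot0r.
  by rewrite !big_nat_recr//= qdotDr /= IHn pvm_qdot.
by apply: cvg_comp; [exact: cvg_qre_qdot h|].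
Qed.

HB.instance Definition _ := isMeasure.Build _ _ _ (spectral_dist E x)
  dist0 dist_ge0 dist_sigma_additive.

End SpectralDist.

(* T = \int t dE(t) in the weak sense; by polarization the quadratic form
   determines the operator. *)
Definition is_spectral_measure (R : realType) (H : qhilbertType R) (T : bop H)
    (E : pvm H) := forall x : H,
  (spectral_dist E x).-integrable setT (EFin : measurableTypeR R -> \bar R) /\
  qdot x (T x) = (\int[spectral_dist E x]_(t in setT) (t : R))%:A.

(* Main.v *)
Require Import Defs.
From HB Require Import structures.
From mathcomp Require Import all_boot all_order all_algebra.
From mathcomp Require Import ring lra.
From mathcomp Require Import all_classical all_reals all_analysis.
From mathcomp Require Import measurable_realfun.
From mathcomp.analysis.showcase Require Import summability.

(** Let [F s = S_L^-1(s, T)] and let [t] be a point of the spectrum. On the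
  spectral subspace of an interval [B = ]a, b]] containing [t], the operator [T]
  is within [b - a] of [t], so that [E B * F s] is within [O(b - a)] of
  [E B * L ((s - t)^-1)], uniformly for [s] on the curves. Integrating, [E B * P]
  is within [O(b - a)] of [E B] times the winding number of the curves around
  [t], which is 1 if [t] belongs to [Delta] and 0 otherwise. If [t] is not in
  the spectrum, [E B = 0] for small [B]. Hence [D = P - E(Delta)] satisfies
  [`|E B D x|^2 = O((b - a)^2)] for all small [B] around any given point; summing
  over fine partitions of an interval [J] yields [E J D x = 0], so [D = 0]. *)

Set Implicit Arguments.
Unset Strict Implicit.
Unset Printing Implicit Defensive.

Import Order.TTheory GRing.Theory Num.Theory.
Import numFieldNormedType.Exports.
Local Open Scope classical_set_scope.
Local Open Scope ring_scope.

(** The obstacle is that [L q] need not commute with [T] or with the values of [E], so that [P] is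
    not known beforehand to respect the spectral subspaces. Only a left factor [E B] is used: the
    difference of [F s] and [L ((s - t)^-1)] has [T - t] as a left factor, which [E B] makes small
    whatever stands to its right. What remains is [E B * L w] with [w] the winding number around
    [t]; as [w] is the real number 0 or 1, [L w] is a real multiple of the identity and the lack of
    commutation no longer matters. The constant in the local bound depends on [t], through its
    distance to the curves, and so does the length below which the bound is used. The passage to the
    whole of [J] is therefore an interval induction on a property that is additive over adjacent
    intervals: the squared norm is additive by Pythagoras, and half-open intervals fit together
    without overlap. Since [line_integral] is 0 by convention when the sums diverge, no estimate is
    available before existence, which rests on the completeness of [quat R] and [bop H]. *)

(** * Induction on real intervals, and clamping to an interval *)

Section IntervalInduction.
Context {R : realType}.

(** The supremum of the [s] with [P a s] can be passed by the local hypothesis at that very point,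
    unless it is [b]. No uniform [d] is asked for, so this serves wherever compactness of an
    interval is needed. *)
Lemma cousin (P : R -> R -> Prop) a b :
  (forall x y z, x <= y -> y <= z -> P x y -> P y z -> P x z) ->
  (forall t, a <= t <= b -> exists2 d, 0 < d &
     forall x y, x <= t -> t <= y -> y - x < d -> P x y) ->
  a <= b -> P a b.
Proof.
move=> Padd Ploc ab.
pose S := [set s | a <= s <= b /\ P a s].
have Sa : S a.
  split; first by rewrite lexx.
  have [|d d0] := Ploc a; first by rewrite lexx.
  by apply; rewrite ?subrr.
have supS : has_sup S by split; [exists a | exists b => s [/andP[]]].
have leS s : S s -> s <= sup S by apply: sup_upper_bound.
have Sb : sup S <= b by apply: ge_sup; [exists a | move=> s [/andP[]]].
have [|d d0 Pd] := Ploc (sup S); first by rewrite leS.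
have d20 : 0 < d / 2 by rewrite divr_gt0.
have [s [/andP[as_ sb] Ps] sS] := sup_adherent d20 supS.
have sleS := leS _ (conj (introT andP (conj as_ sb)) Ps).
pose c := Num.min b (sup S + d / 2).
have Sc : sup S <= c by rewrite le_min Sb lerDl ltW.
have cS : c <= sup S + d / 2 by rewrite ge_min lexx orbT.
have Pac : P a c by apply: (Padd a s) => //; [lra|apply: Pd => //; lra].
have [cb|bc] := ltP c b; last first.
  by rewrite (_ : b = c)//; apply/eqP; rewrite eq_le bc ge_min lexx.
have : c <= sup S by apply: leS; split=> //; apply/andP; split; lra.
have [h|h] := ltP b (sup S + d / 2).
  by move: cb; rewrite /c (min_l (ltW h)) ltxx.
by rewrite /c min_r//; lra.
Qed.

(** Clamping one subdivision to a cell of another gives the part of their common refinement in that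
    cell, the outer points being collapsed to its ends. *)
Definition clamp (a b s : R) := Num.max a (Num.min s b).

Lemma clamp_homo a b s t : s <= t -> clamp a b s <= clamp a b t.
Proof.
rewrite /clamp => st; case: (leP a (Num.min s b)); case: (leP a (Num.min t b));
  case: (leP s b); case: (leP t b); lra.
Qed.

Lemma clampl a b s : a <= b -> s <= a -> clamp a b s = a.
Proof. by rewrite /clamp => ab sa; rewrite max_l// ge_min sa. Qed.

Lemma clampr a b s : a <= b -> b <= s -> clamp a b s = b.
Proof. by rewrite /clamp => ab bs; rewrite min_r// max_r. Qed.

(** Disjoint cells give two zero increments, overlapping ones give the same intersection whichever
    is clamped to the other. The refinement is thus symmetric in the two subdivisions; the
    inequalities of the second case later bound the distance between tags. *)
Lemma clampP a b c d : a <= b -> c <= d ->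
  [\/ clamp a b c = clamp a b d /\ clamp c d a = clamp c d b |
      [/\ clamp a b c = clamp c d a, clamp a b d = clamp c d b,
          c <= b & a <= d]].
Proof.
move=> ab cd; have [bc|cb] := ltP b c.
  by left; split; [rewrite !(clampr ab)|rewrite !(clampl cd)] => //; lra.
have [da|ad] := ltP d a.
  by left; split; [rewrite !(clampl ab)|rewrite !(clampr cd)] => //; lra.
right; split=> //; rewrite /clamp.
  by rewrite !min_l// maxC.
by rewrite minC !max_r// le_min ?ad ?cb ?ab ?cd.
Qed.

End IntervalInduction.

(** * Existence and comparison of Riemann-Stieltjes line integrals *)

Section LineIntegralExistence.
Context {R : realType}.
Implicit Types (g : R -> quat R) (t tag : nat -> R).

Lemma subdivision_homo n t : subdivision n t ->
  forall i j, (i <= j <= n)%N -> t i <= t j.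
Proof.
move=> [_ _ ht] i j /andP[ij jn].
elim: j ij jn => [|j IHj]; first by rewrite leqn0 => /eqP ->.
rewrite leq_eqVlt => /predU1P[->//|]; rewrite ltnS => ij jn.
by rewrite (le_trans (IHj ij (ltnW jn)))// ht.
Qed.

Lemma subdivision_itv n t : subdivision n t ->
  forall i, (i <= n)%N -> 0 <= t i <= 1.
Proof.
move=> st i iN; have [t0 t1 _] := st.
by rewrite -{1}t0 -t1 !(subdivision_homo st)// ?leqnn iN.
Qed.

Lemma subdivision_gt0 n t : subdivision n t -> (0 < n)%N.
Proof. by case: n => // -[t0 t1 _]; move: t1; rewrite t0 => /eqP; rewrite eq_sym oner_eq0. Qed.

Lemma tag_itv d n t tag : tagged_subdivision d n t tag ->
  forall k, (k < n)%N -> 0 <= tag k <= 1.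
Proof.
move=> [st ht] k kn; have [/andP[h1 h2] _] := ht k kn.
have /andP[h3 _] := subdivision_itv st (ltnW kn).
by have /andP[_ h4] := subdivision_itv st kn; lra.
Qed.

Definition uniform_subdivision (N k : nat) : R := k%:R / N.+1%:R.

Lemma uniform_tagged (d : R) N : N.+1%:R^-1 < d ->
  tagged_subdivision d N.+1 (uniform_subdivision N) (uniform_subdivision N).
Proof.
move=> Nd; rewrite /uniform_subdivision; split; first split.
- by rewrite mul0r.
- by rewrite divff.
- by move=> k _; rewrite ler_pM2r ?invr_gt0// ler_nat.
move=> k _; split; first by rewrite lexx ler_pM2r ?invr_gt0// ler_nat /=.
by rewrite -mulrBl -natrB// subSnn mul1r.
Qed.

Lemma tagged_exists (d : R) : 0 < d -> exists n t tag, tagged_subdivision d n t tag.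
Proof.
move=> d0; have [N _ hN] := near_infty_natSinv_lt (PosNum d0).
by exists N.+1, (uniform_subdivision N), (uniform_subdivision N); apply: uniform_tagged; apply: hN => /=.
Qed.

(* The lexicographic merge [i * m + j |-> clamp (t i) (t i.+1) (t' j)] is a
   subdivision. *)
Lemma merge_variation g (M : R) n t m t' :
  (forall n t, subdivision n t ->
    \sum_(k < n) `|g (t k.+1) - g (t k)| <= M) ->
  subdivision n t -> subdivision m t' ->
  \sum_(0 <= i < n) \sum_(0 <= j < m) `|g (clamp (t i) (t i.+1) (t' j.+1)) -
     g (clamp (t i) (t i.+1) (t' j))| <= M.
Proof.
move=> gM st st'; have m0 := subdivision_gt0 st'.
have [t0 t1 ht] := st; have [t'0 t'1 ht'] := st'.
pose u i := clamp (t (i %/ m)%N) (t (i %/ m).+1) (t' (i %% m)%N).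
have ue i j : (i < n)%N -> (j <= m)%N ->
    u (i * m + j)%N = clamp (t i) (t i.+1) (t' j).
  move=> iN; rewrite leq_eqVlt => /predU1P[->|jm]; last first.
    by rewrite /u divnMDl// divn_small// addn0 modnMDl modn_small.
  have /andP[ti0 ti1] := subdivision_itv st iN.
  rewrite -mulSnr /u mulnK// modnMl t'0 t'1 (clampr (ht _ iN))//.
  (* Index [j = m] is also the start of the next row. After the last row [t n.+1] is arbitrary, but
     clamping [t' 0 = 0] from below by [t n = 1] still returns 1. *)
  have [->|iN'] := eqVneq i.+1 n.
    by rewrite /clamp t1 max_l// ge_min ler01.
  by rewrite clampl// ht// ltn_neqAle iN' iN.
have su : subdivision (n * m) u.
  split.
  - have := @ue 0%N 0%N (subdivision_gt0 st) (leq0n _).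
    by rewrite mul0n add0n => ->; rewrite t0 t'0 clampl// -t0 ht// (subdivision_gt0 st).
  - have n0 := subdivision_gt0 st.
    have -> : (n * m = n.-1 * m + m)%N by rewrite -mulSnr prednK.
    have n1 : (n.-1 < n)%N by rewrite prednK.
    rewrite ue// t'1; have := ht _ n1; rewrite prednK// t1 => h.
    by rewrite clampr.
  - move=> k kN; rewrite (divn_eq k m).
    have kn : (k %/ m < n)%N by rewrite ltn_divLR.
    have km : (k %% m < m)%N by rewrite ltn_mod.
    by rewrite -addnS !ue// 1?ltnW//; apply: clamp_homo; apply: ht'.
apply: le_trans (gM _ _ su); rewrite -(big_mkord xpredT (fun k => `|g (u k.+1) - g (u k)|)).
rewrite big_nat_mul le_eqVlt; apply/orP; left; apply/eqP; apply: eq_big_nat => i /andP[_ iN].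
rewrite -[in RHS](add0n (i * m)%N) big_addn mulSnr addKn.
apply: eq_big_nat => j /andP[_ jm].
by rewrite addnC -addnS !ue// ltnW.
Qed.

Lemma increment_clamp g n t m t' i : subdivision n t -> subdivision m t' ->
  (i < n)%N ->
  g (t i.+1) - g (t i) = \sum_(0 <= j < m)
    (g (clamp (t i) (t i.+1) (t' j.+1)) - g (clamp (t i) (t i.+1) (t' j))).
Proof.
move=> st st' iN; have [t0 t1 ht] := st; have [t'0 t'1 ht'] := st'.
rewrite telescope_sumr// t'0 t'1.
have /andP[_ ti1] := subdivision_itv st iN.
have /andP[ti0 _] := subdivision_itv st (ltnW iN).
by rewrite clampr// ?clampl// ht.
Qed.

Section Form.
Context {V : normedModType R}.
Variables (g : R -> quat R) (f : quat R -> quat R -> V) (M : R).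
Hypothesis gM : forall n t, subdivision n t ->
  \sum_(k < n) `|g (t k.+1) - g (t k)| <= M.
Hypothesis fD : forall s h h', f s (h + h') = f s h + f s h'.

Let f0 s : f s 0 = 0.
Proof. by apply: (addrI (f s 0)); rewrite -fD !addr0. Qed.

Let fsum s (r : seq nat) (F : nat -> quat R) :
  f s (\sum_(i <- r) F i) = \sum_(i <- r) f s (F i).
Proof. by elim/big_rec2 : _ => // i x y _ <-. Qed.

Let rs n t tag := \sum_(k < n) f (g (tag k)) (g (t k.+1) - g (t k)).

(** On the common refinement both sums have the same increments and differ only in their tags. Tags
    of overlapping cells are less than [d + d] apart, and the refined increments add up to at most
    [M]. *)
Lemma riemann_sum_close (d e : R) : 0 <= e ->
  (forall s s', 0 <= s <= 1 -> 0 <= s' <= 1 -> `|s - s'| < d + d ->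
     forall h, `|f (g s) h - f (g s') h| <= e * `|h|) ->
  forall n t tag m t' tag', tagged_subdivision d n t tag ->
    tagged_subdivision d m t' tag' -> `|rs n t tag - rs m t' tag'| <= e * M.
Proof.
move=> e0 fe n t tag m t' tag' ht ht'.
have [[st hd] [st' hd']] := (ht, ht').
pose D i j := g (clamp (t i) (t i.+1) (t' j.+1)) - g (clamp (t i) (t i.+1) (t' j)).
pose D' i j := g (clamp (t' j) (t' j.+1) (t i.+1)) - g (clamp (t' j) (t' j.+1) (t i)).
have mono i : (i < n)%N -> t i <= t i.+1 by case: st => _ _; apply.
have mono' j : (j < m)%N -> t' j <= t' j.+1 by case: st' => _ _; apply.
have DD' i j : (i < n)%N -> (j < m)%N -> D i j = D' i j.
  move=> iN jm; rewrite /D /D'.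
  by case: (clampP (mono i iN) (mono' j jm)) => [[-> ->]|[-> -> _ _]//]; rewrite !subrr.
have rsE : rs n t tag = \sum_(0 <= i < n) \sum_(0 <= j < m) f (g (tag i)) (D i j).
  rewrite /rs -(big_mkord xpredT (fun k => f (g (tag k)) (g (t k.+1) - g (t k)))).
  by apply: eq_big_nat => i /andP[_ iN]; rewrite (increment_clamp g st st' iN) fsum.
have rsE' : rs m t' tag' = \sum_(0 <= i < n) \sum_(0 <= j < m) f (g (tag' j)) (D i j).
  rewrite exchange_big_nat /=.
  rewrite /rs -(big_mkord xpredT (fun k => f (g (tag' k)) (g (t' k.+1) - g (t' k)))).
  apply: eq_big_nat => j /andP[_ jm]; rewrite (increment_clamp g st' st jm) fsum.
  by apply: eq_big_nat => i /andP[_ iN]; rewrite DD'.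
apply: le_trans (ler_wpM2l e0 (merge_variation gM st st')).
rewrite rsE rsE' -sumrB mulr_sumr (le_trans (ler_norm_sum _ _ _))//.
rewrite 2!big_nat ler_sum// => i /andP[_ iN].
rewrite -sumrB mulr_sumr (le_trans (ler_norm_sum _ _ _))//.
rewrite 2!big_nat ler_sum// => j /andP[_ jm].
case: (clampP (mono i iN) (mono' j jm)) => [[h _]|[_ _ h1 h2]].
  by rewrite /D h !subrr !f0 subrr !normr0 mulr0.
apply: fe; [exact: tag_itv ht _ iN|exact: tag_itv ht' _ jm|].
have [/andP[a1 a2] a3] := hd i iN; have [/andP[b1 b2] b3] := hd' j jm.
by rewrite ltr_norml; apply/andP; split; lra.
Qed.

End Form.

Definition unif_continuous_along (V : normedModType R) g (f : quat R -> quat R -> V) :=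
  forall e : R, 0 < e -> exists2 d : R, 0 < d &
    forall s s', 0 <= s <= 1 -> 0 <= s' <= 1 -> `|s - s'| < d ->
    forall h, `|f (g s) h - f (g s') h| <= e * `|h|.

(** The sums over uniform subdivisions form a Cauchy sequence by [riemann_sum_close], which also
    brings every fine tagged sum close to their limit. *)
Lemma is_line_integral_exists (V : completeNormedModType R) g
    (f : quat R -> quat R -> V) :
  rectifiable g -> (forall s h h', f s (h + h') = f s h + f s h') ->
  unif_continuous_along g f -> exists v, is_line_integral g f v.
Proof.
move=> [M gM] fD fg.
have M0 : 0 <= M.
  have [n [t [tag [st _]]]] := tagged_exists (@ltr01 R).
  by apply: le_trans (gM _ _ st); apply: sumr_ge0.
pose rs n t tag := \sum_(k < n) f (g (tag k)) (g (t k.+1) - g (t k)).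
have close e : 0 < e -> exists2 d : R, 0 < d & forall n t tag m t' tag',
    tagged_subdivision d n t tag -> tagged_subdivision d m t' tag' ->
    `|rs n t tag - rs m t' tag'| <= e.
  move=> e0; have M10 : 0 < M + 1 by rewrite ltr_wpDl.
  have [d d0 hd] := fg _ (divr_gt0 e0 M10).
  exists (d / 2); first by rewrite divr_gt0.
  move=> n t tag m t' tag' ht ht'.
  have e1 : 0 <= e / (M + 1) by rewrite divr_ge0// ltW.
  apply: le_trans (_ : e / (M + 1) * M <= _); last first.
    rewrite mulrAC -mulrA ler_piMr// ?ltW// ltr_pdivrMr// mul1r ltrDl//.
  apply: (riemann_sum_close gM fD e1 _ ht ht') => s s' s1 s2 s3 h.
  by apply: hd => //; lra.
pose S N := rs N.+1 (uniform_subdivision N) (uniform_subdivision N).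
have Sfine d : 0 < d -> \forall N \near \oo,
    tagged_subdivision d N.+1 (uniform_subdivision N) (uniform_subdivision N).
  move=> d0; have := near_infty_natSinv_lt (PosNum d0).
  by apply: filterS => N; exact: uniform_tagged.
have /cauchy_cvgP Scvg : cauchy (S @ \oo).
  apply: cauchy_exP => e e0.
  have [d d0 hd] := close (e / 2) (divr_gt0 e0 (ltr0n _ 2)).
  have [N0 _ hN0] := Sfine _ d0.
  exists (S N0); exists N0 => // N /= NN0; rewrite -ball_normE /=.
  rewrite (@le_lt_trans _ _ (e / 2))//; last by rewrite ltr_pdivrMr// ltr_pMr// ltr1n.
  by apply: hd; apply: hN0 => /=.
exists (lim (S @ \oo)) => e e0.
have [d d0 hd] := close (e / 2) (divr_gt0 e0 (ltr0n _ 2)).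
exists d => // n t tag ht; rewrite (@le_lt_trans _ _ (e / 2))//; last by rewrite ltr_pdivrMr// ltr_pMr// ltr1n.
have cv : `|rs n t tag - S N| @[N --> \oo] --> `|rs n t tag - lim (S @ \oo)|.
  by apply: cvg_norm; apply: cvgB => //; exact: cvg_cst.
rewrite -(cvg_lim _ cv)//; apply: limr_le; first exact: cvgP cv.
by near=> N; apply: hd => //; near: N; exact: Sfine.
Unshelve. all: by end_near. Qed.

Lemma line_integralP (V : completeNormedModType R) g (f : quat R -> quat R -> V) :
  rectifiable g -> (forall s h h', f s (h + h') = f s h + f s h') ->
  unif_continuous_along g f -> is_line_integral g f (line_integral g f).
Proof.
move=> gr fD fc; rewrite /line_integral.
by have [v hv] := is_line_integral_exists gr fD fc; apply: (xgetPex 0 (ex_intro _ v hv)).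
Qed.

(** One tagged subdivision fine enough for both integrals reduces the claim to the integrands. The
    bound [c] only controls the approximation errors, which are arbitrarily small, and so is absent
    from the conclusion. *)
Lemma line_integral_close (V1 V2 W : normedModType R) g
    (f1 : quat R -> quat R -> V1) (f2 : quat R -> quat R -> V2) v1 v2
    (A : V1 -> W) (B : V2 -> W) (c eta M : R) :
  (forall n t, subdivision n t -> \sum_(k < n) `|g (t k.+1) - g (t k)| <= M) ->
  (forall x y, A (x + y) = A x + A y) -> (forall x y, B (x + y) = B x + B y) ->
  (forall x, `|A x| <= c * `|x|) -> (forall x, `|B x| <= c * `|x|) ->
  (forall s h, 0 <= s <= 1 -> `|A (f1 (g s) h) - B (f2 (g s) h)| <= eta * `|h|) ->
  0 <= eta ->
  is_line_integral g f1 v1 -> is_line_integral g f2 v2 ->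
  `|A v1 - B v2| <= eta * M.
Proof.
move=> gM AD BD Ac Bc AB eta0 h1 h2; apply/ler_addgt0Pr => e e0.
have A0 : A 0 = 0 by apply: (addrI (A 0)); rewrite -AD !addr0.
have B0 : B 0 = 0 by apply: (addrI (B 0)); rewrite -BD !addr0.
have [c1 c1E] : exists c1, c1 = `|c| + 1 by eexists.
have c10 : 0 < c1 by rewrite c1E ltr_wpDl.
have cc1 : c <= c1 by rewrite c1E (le_trans (ler_norm c))// lerDl.
have e2 : 0 < e / c1 / 2 by rewrite !divr_gt0.
have [d d0 hd] := h1 _ e2; have [d' d'0 hd'] := h2 _ e2.
have [n [t [tag tt]]] : exists n t tag, tagged_subdivision (Num.min d d') n t tag.
  by apply: tagged_exists; rewrite lt_min d0.
have [st ht] := tt.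
have := hd n t tag; have := hd' n t tag.
set S2 := \sum_(k < n) f2 _ _; set S1 := \sum_(k < n) _ => k2 k1.
have {}k1 : `|S1 - v1| < e / c1 / 2.
  by apply: k1; split=> // k /ht[? ]; rewrite lt_min => /andP[].
have {}k2 : `|S2 - v2| < e / c1 / 2.
  by apply: k2; split=> // k /ht[? ]; rewrite lt_min => /andP[].
have AB' : `|A S1 - B S2| <= eta * M.
  apply: le_trans (ler_wpM2l eta0 (gM _ _ st)).
  rewrite (big_morph A AD A0) (big_morph B BD B0) -sumrB mulr_sumr.
  rewrite (le_trans (ler_norm_sum _ _ _))// ler_sum// => k _.
  by apply: AB; exact: tag_itv tt _ (ltn_ord k).
have -> : A v1 - B v2 = (A S1 - B S2) - (A (S1 - v1) - B (S2 - v2)).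
  have -> : A S1 = A (S1 - v1) + A v1 by rewrite -AD subrK.
  have -> : B S2 = B (S2 - v2) + B v2 by rewrite -BD subrK.
  by rewrite opprD addrACA [X in _ = X - _]addrC addrK.
have kA : `|A (S1 - v1)| <= e / 2.
  rewrite (le_trans (Ac _))//.
  have -> : e / 2 = c1 * (e / c1 / 2) by field; rewrite gt_eqF.
  by rewrite (le_trans (ler_wpM2r _ cc1))// ler_wpM2l// ltW.
have kB : `|B (S2 - v2)| <= e / 2.
  rewrite (le_trans (Bc _))//.
  have -> : e / 2 = c1 * (e / c1 / 2) by field; rewrite gt_eqF.
  by rewrite (le_trans (ler_wpM2r _ cc1))// ler_wpM2l// ltW.
rewrite (le_trans (ler_normB _ _))// lerD//.
rewrite (le_trans (ler_normB _ _))//; lra.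
Qed.

End LineIntegralExistence.

(** * Multiplicativity of the norm and completeness of the quaternions *)

Section QuaternionNorm.
Context {R : realType}.
Implicit Types x y : quat R.

Lemma qsqnormE x : `|x| ^+ 2 = qsqnorm x.
Proof. by rewrite sqr_sqrtr// qsqnorm_ge0. Qed.

Lemma qnormM x y : `|x * y| = `|x| * `|y|.
Proof.
apply/eqP; rewrite -(eqrXn2 (_ : (0 < 2)%N)) ?mulr_ge0//.
by apply/eqP; rewrite exprMn !qsqnormE /qsqnorm /=; ring.
Qed.

Lemma qnormr (r : R) : `|r%:A : quat R| = `|r|.
Proof.
rewrite normrZ (_ : `|1 : quat R| = 1) ?mulr1//.
by apply/eqP; rewrite -(eqrXn2 (_ : (0 < 2)%N))// qsqnormE /qsqnorm /= !expr0n /= !addr0.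
Qed.

Lemma qnorm_conj x : `|qconj x| = `|x|.
Proof.
apply/eqP; rewrite -(eqrXn2 (_ : (0 < 2)%N))//.
by apply/eqP; rewrite !qsqnormE /qsqnorm /=; ring.
Qed.

Lemma norm_imag_unit (I : quat R) : imag_unit I -> `|I| = 1.
Proof.
move=> I2; apply/eqP; rewrite -(eqrXn2 (_ : (0 < 2)%N))//.
by rewrite expr2 -qnormM -expr2 I2 normrN -(scale1r 1) qnormr normr1 expr1n.
Qed.

Lemma qcomp_le_norm x : [/\ `|qre x| <= `|x|, `|qim1 x| <= `|x|,
  `|qim2 x| <= `|x| & `|qim3 x| <= `|x|].
Proof.
have s := (sqr_ge0 (qre x), sqr_ge0 (qim1 x), sqr_ge0 (qim2 x), sqr_ge0 (qim3 x)).
case: s => -[[h0 h1] h2] h3.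
by split; rewrite -(@ler_pXn2r _ 2) ?nnegrE// qsqnormE -normrX ger0_norm// /qsqnorm; lra.
Qed.

Lemma quatE x : x = (qre x)%:A + qim1 x *: Quat 0 1 0 0 + qim2 x *: Quat 0 0 1 0 +
  qim3 x *: Quat 0 0 0 1.
Proof. by apply: quat_ext => /=; ring. Qed.

Lemma qnorm_le_comp x : `|x| <= `|qre x| + `|qim1 x| + `|qim2 x| + `|qim3 x|.
Proof.
have u (a b c d : R) : a ^+ 2 + b ^+ 2 + c ^+ 2 + d ^+ 2 = 1 -> `|Quat a b c d| = 1.
  by move=> h; apply/eqP; rewrite -(eqrXn2 (_ : (0 < 2)%N))// qsqnormE /qsqnorm /= h expr1n.
rewrite {1}(quatE x) (le_trans (ler_normD _ _))// lerD//; last first.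
  by rewrite normrZ u ?mulr1// !expr0n /=; ring.
rewrite (le_trans (ler_normD _ _))// lerD//; last first.
  by rewrite normrZ u ?mulr1// !expr0n /=; ring.
rewrite (le_trans (ler_normD _ _))// lerD//; last first.
  by rewrite normrZ u ?mulr1// !expr0n /=; ring.
by rewrite qnormr.
Qed.

Lemma quat_cauchy_cvg (F : set_system (quat R)) : ProperFilter F ->
  cauchy F -> cvg F.
Proof.
move=> FF /cauchyP Fc.
have comp (p : quat R -> R) : (forall x y, p (x - y) = p x - p y) ->
    (forall x, `|p x| <= `|x|) -> cvg (p @ F).
  move=> pB pn; apply/cauchy_cvgP; apply: cauchy_exP => e e0.
  have [x Fx] := Fc e e0; exists (p x).
  suff : F (p @^-1` ball (p x) e) by [].
  apply: filterS Fx => y; rewrite -!ball_normE /= -pB => /le_lt_trans; apply.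
  exact: pn.
have c0 := comp (@qre R) (fun x y => erefl) (fun x => let: And4 h _ _ _ := qcomp_le_norm x in h).
have c1 := comp (@qim1 R) (fun x y => erefl) (fun x => let: And4 _ h _ _ := qcomp_le_norm x in h).
have c2 := comp (@qim2 R) (fun x y => erefl) (fun x => let: And4 _ _ h _ := qcomp_le_norm x in h).
have c3 := comp (@qim3 R) (fun x y => erefl) (fun x => let: And4 _ _ _ h := qcomp_le_norm x in h).
pose l := Quat (lim (@qre R @ F)) (lim (@qim1 R @ F)) (lim (@qim2 R @ F)) (lim (@qim3 R @ F)).
apply/cvg_ex; exists l; apply/cvgrPdist_lt => e e0.
have e4 : 0 < e / 4 by rewrite divr_gt0.
move/cvgrPdist_lt : c0 => /(_ _ e4) c0; move/cvgrPdist_lt : c1 => /(_ _ e4) c1.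
move/cvgrPdist_lt : c2 => /(_ _ e4) c2; move/cvgrPdist_lt : c3 => /(_ _ e4) c3.
near=> x; apply: le_lt_trans (qnorm_le_comp _) _ => /=.
rewrite (_ : e = e / 4 + e / 4 + e / 4 + e / 4); last by field.
by rewrite !ltrD//; near: x.
Unshelve. all: by end_near. Qed.

HB.instance Definition _ := Uniform_isComplete.Build (quat R) quat_cauchy_cvg.

Lemma qdot_real {H : qhilbertType R} (x : H) : qdot x x = (`|x| ^+ 2)%:A.
Proof.
rewrite sqr_normE; have := qdotC x x.
by case: (qdot x x) => a b c d [h1 h2 h3]; apply: quat_ext => /=; lra.
Qed.

Lemma norm_rscale {H : qhilbertType R} (x : H) (q : quat R) : `|x ** q| = `|x| * `|q|.
Proof.
apply/eqP; rewrite -(eqrXn2 (_ : (0 < 2)%N)) ?mulr_ge0// exprMn qsqnormE.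
apply/eqP; rewrite sqr_normE qdotZr qdotC qdotZr qdot_real.
by rewrite /qsqnorm /=; ring.
Qed.

End QuaternionNorm.

(** * The Banach algebra of bounded operators *)

Section OperatorAlgebra.
Context {R : realType} {H : qhilbertType R}.
Implicit Types A B C X : bop H.

Lemma bopE_add A B x : (A + B) x = A x + B x. Proof. by []. Qed.
Lemma bopE_opp A x : (- A) x = - A x. Proof. by []. Qed.
Lemma bopE_mul A B x : (A * B) x = A (B x). Proof. by []. Qed.
Lemma bopE_scale (r : R) A x : (r *: A) x = r *: A x. Proof. by []. Qed.
Lemma bopE_1 x : (1 : bop H) x = x. Proof. by []. Qed.
Lemma bopE_0 x : (0 : bop H) x = 0. Proof. by []. Qed.
Definition bopE := (bopE_add, bopE_opp, bopE_mul, bopE_scale, bopE_1, bopE_0).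

Lemma bopN A x : A (- x) = - A x.
Proof. by rewrite -scaleN1r bopZ scaleN1r. Qed.

Lemma bopB A x y : A (x - y) = A x - A y.
Proof. by rewrite bopD bopN. Qed.

Lemma bop_scaleAl (r : R) A B : (r *: A) * B = r *: (A * B).
Proof. exact: bop_ext. Qed.

Lemma bop_scaleAr (r : R) A B : A * (r *: B) = r *: (A * B).
Proof. by apply: bop_ext => x; rewrite !bopE bopZ. Qed.

Lemma bop_norm_ub A x : `|A x| <= `|A| * `|x|.
Proof. exact: opnorm_ub. Qed.

Lemma bop_norm_le A (M : R) : 0 <= M -> (forall x, `|A x| <= M * `|x|) -> `|A| <= M.
Proof.
move=> M0 h; apply: opnorm_le => x x1.
by rewrite (le_trans (h x))// ler_piMr.
Qed.

Lemma bop_normM A B : `|A * B| <= `|A| * `|B|.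
Proof.
apply: bop_norm_le => [|x]; first by rewrite mulr_ge0.
by rewrite bopE (le_trans (bop_norm_ub A _))// -mulrA ler_wpM2l// bop_norm_ub.
Qed.

(** Only an inequality, since [H] may be zero. *)
Lemma bop_norm1 : `|1 : bop H| <= 1.
Proof. by apply: bop_norm_le => // x; rewrite mul1r. Qed.

Lemma cvg_rscale (q : quat R) (I : Type) (F : set_system I) (FF : Filter F)
    (f : I -> H) (l : H) :
  f @ F --> l -> (fun i => f i ** q) @ F --> l ** q.
Proof.
move=> Fl; apply/cvgrPdist_le => e e0.
have q1 : 0 < `|q| + 1 by rewrite ltr_wpDl.
have /cvgrPdist_le/(_ _ (divr_gt0 e0 q1)) := Fl; apply: filterS => x hx.
have -> : l ** q - f x ** q = (l - f x) ** q by rewrite rscaleDl -[- f x]scaleN1r rscaleZl scaleN1r.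
rewrite norm_rscale (le_trans (ler_wpM2r _ hx))//.
by rewrite mulrAC ler_pdivrMr// ler_pM2l// lerDl.
Qed.

(** Pointwise limits exist in [H]; the Cauchy bounds pass to the limit as multiples of [|x|], which
    gives both a bounded limit and convergence in operator norm. *)
Lemma bop_cauchy_cvg (F : set_system (bop H)) : ProperFilter F ->
  cauchy F -> cvg F.
Proof.
move=> FF /cauchyP Fc.
have ptc x : cvg ((fun A : bop H => A x) @ F).
  apply/cauchy_cvgP; apply: cauchy_exP => e e0.
  have x1 : 0 < `|x| + 1 by rewrite ltr_wpDl.
  have [A FA] := Fc _ (divr_gt0 e0 x1); exists (A x).
  suff : F ((fun B : bop H => B x) @^-1` ball (A x) e) by [].
  apply: filterS FA => B; rewrite -!ball_normE /= => AB.
  rewrite (@le_lt_trans _ _ (`|A - B| * `|x|))//; first exact: (bop_norm_ub (A - B)).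
  have [->|x0] := eqVneq x 0; first by rewrite normr0 mulr0.
  rewrite (@lt_le_trans _ _ (e / (`|x| + 1) * `|x|))// ?ltr_pM2r ?normr_gt0//.
  by rewrite mulrAC ler_pdivrMr// ler_pM2l// lerDl.
pose l x := lim ((fun A : bop H => A x) @ F).
have close A e : F (ball A e) -> forall x, `|A x - l x| <= e * `|x|.
  move=> FA x.
  have cv : (fun B : bop H => `|A x - B x|) @ F --> `|A x - l x|.
    by apply: cvg_norm; apply: cvgB; [exact: cvg_cst|exact: ptc].
  rewrite -(cvg_lim _ cv)//; apply: limr_le; first exact: cvgP cv.
  apply: filterS FA => B; rewrite -ball_normE /= => /ltW AB.
  by rewrite (le_trans (bop_norm_ub (A - B) x))// ler_wpM2r.
have ll : right_linear l.
  split=> [x y|x q].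
    apply: cvg_lim => //.
    rewrite (_ : (fun A : bop H => _) = (fun A => A x) \+ (fun A => A y)).
      exact: (cvgD (ptc x) (ptc y)).
    by apply/funext => A; rewrite bopD.
  apply: cvg_lim => //.
  rewrite (_ : (fun A : bop H => _) = (fun A => A x ** q)).
    exact: (@cvg_rscale q _ F _ (fun A : bop H => A x) _ (ptc x)).
  by apply/funext => A; rewrite bopZr.
have lb : bounded_op l.
  have [A FA] := Fc 1 ltr01; exists (`|A| + 1) => x.
  have -> : l x = A x - (A x - l x) by rewrite subKr.
  rewrite (le_trans (ler_normB _ _))// mulrDl lerD ?bop_norm_ub//.
  exact: close.
apply/cvg_ex; exists (Bop ll lb); apply/cvgrPdist_le => e e0.
have e2 : 0 < e / 2 by rewrite divr_gt0.
have [A FA] := Fc _ e2; apply: filterS (FA) => B; rewrite -ball_normE /= => AB.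
apply: bop_norm_le; [exact: ltW|move=> x; rewrite !bopE /=].
have -> : l x - B x = (A - B) x - (A x - l x) by rewrite !bopE opprB [RHS]addrC subrKA.
rewrite (splitr e) mulrDl (le_trans (ler_normB _ _))// lerD//; last exact: close.
by rewrite (le_trans (bop_norm_ub _ _))// ler_wpM2r// ltW.
Qed.

HB.instance Definition _ := Uniform_isComplete.Build (bop H) bop_cauchy_cvg.

Lemma cvg_bop_mull A (u : nat -> bop H) (l : bop H) :
  u @ \oo --> l -> A * u n @[n --> \oo] --> A * l.
Proof.
move=> ul; apply/cvgrPdist_le => e e0.
have A1 : 0 < `|A| + 1 by rewrite ltr_wpDl.
have /cvgrPdist_le/(_ _ (divr_gt0 e0 A1)) := ul; apply: filterS => n hn.
rewrite -mulrBr (le_trans (bop_normM _ _))// (le_trans (ler_wpM2l _ hn))//.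
by rewrite mulrCA ler_piMr// ?ltW// ltr_pdivrMr// mul1r ltrDl.
Qed.

Lemma cvg_bop_mulr A (u : nat -> bop H) (l : bop H) :
  u @ \oo --> l -> u n * A @[n --> \oo] --> l * A.
Proof.
move=> ul; apply/cvgrPdist_le => e e0.
have A1 : 0 < `|A| + 1 by rewrite ltr_wpDl.
have /cvgrPdist_le/(_ _ (divr_gt0 e0 A1)) := ul; apply: filterS => n hn.
rewrite -mulrBl (le_trans (bop_normM _ _))// (le_trans (ler_wpM2r _ hn))//.
by rewrite -mulrA ler_piMr// ?ltW// ltr_pdivrMl// mulr1 ltrDl.
Qed.

(** The partial sums of the powers of [X] converge absolutely and satisfy
    [S (n+1) = 1 + X * S n = 1 + S n * X]; in the limit these are the two inverse identities. *)
Lemma neumann X : `|X| < 1 -> invertible (1 - X).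
Proof.
move=> X1; pose u n := X ^+ n.
have ub n : `|u n| <= geometric 1 `|X| n.
  rewrite /geometric /= mul1r /u; elim: n => [|n IHn].
    by rewrite !expr0 bop_norm1.
  by rewrite !exprS (le_trans (bop_normM _ _))// ler_wpM2l.
have cv : cvgn (series u).
  apply: normed_cvg; apply: (@series_le_cvg _ _ (geometric 1 `|X|)) => [n|n||].
  - exact: normr_ge0.
  - by rewrite /geometric /= mul1r exprn_ge0.
  - exact: ub.
  - by apply: is_cvg_geometric_series; rewrite normr_id.
have cvS : (fun n => series u n.+1) @ \oo --> lim (series u @ \oo).
  by rewrite cvg_shiftS.
have SEl n : series u n.+1 = 1 + X * series u n.
  rewrite /series /= big_nat_recl// {1}/u expr0 mulr_sumr; congr (_ + _).
  by apply: eq_bigr => i _; rewrite /u exprS.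
have SEr n : series u n.+1 = 1 + series u n * X.
  rewrite /series /= big_nat_recl// {1}/u expr0 mulr_suml; congr (_ + _).
  by apply: eq_bigr => i _; rewrite /u exprSr.
exists (lim (series u @ \oo)); split.
- rewrite mulrBl mul1r; apply/eqP; rewrite subr_eq; apply/eqP.
  apply: (cvg_unique _ cvS) => //.
  rewrite (funext SEl); apply: cvgD; first exact: cvg_cst.
  exact: cvg_bop_mull.
- rewrite mulrBr mulr1; apply/eqP; rewrite subr_eq; apply/eqP.
  apply: (cvg_unique _ cvS) => //.
  rewrite (funext SEr); apply: cvgD; first exact: cvg_cst.
  exact: cvg_bop_mulr.
Qed.

Lemma bop_invP A : invertible A -> is_inverse A (bop_inv A).
Proof. by move=> [B hB]; apply: (xgetPex 0 (ex_intro _ B hB)). Qed.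

Lemma invertible_perturb A X : invertible A -> `|bop_inv A| * `|X| < 1 ->
  invertible (A + X).
Proof.
move=> /bop_invP; set B := bop_inv A => -[AB BA] BX.
have [Y [h1 h2]] : invertible (1 - - (B * X)).
  by apply: neumann; rewrite normrN (le_lt_trans (bop_normM _ _)).
have -> : A + X = A * (1 - - (B * X)) by rewrite opprK mulrDr mulr1 mulrA AB mul1r.
exists (Y * B); split.
  by rewrite mulrA -(mulrA A) h1 mulr1.
by rewrite mulrA -(mulrA Y) BA mulr1.
Qed.

End OperatorAlgebra.

(** * Real linearity and boundedness of a left scalar multiplication *)

Section LeftScalarMultiplication.
Context {R : realType} {H : qhilbertType R} (L : quat R -> bop H).
Hypothesis hL : left_scalar_mult L.

Lemma lsmM p q : L (p * q) = L p * L q.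
Proof. by have [-> _ _] := hL. Qed.

(** Multiplicativity says nothing about sums: additivity is read off the diagonal action on the
    Hilbert basis, in the limit over finite index sets. *)
Lemma lsmD p q : L (p + q) = L p + L q.
Proof.
have [_ _ [I [e [[_ eb] he]]]] := hL; apply: bop_ext => x.
have tf := @totally_filter I.
have h r := he r (fun i => qdot (e i) x) x (eb x).
apply: (cvg_unique _ (h (p + q))) => //.
rewrite (_ : partial_sum _ = fun J => partial_sum (fun i => e i ** (p * qdot (e i) x)) J +
  partial_sum (fun i => e i ** (q * qdot (e i) x)) J); first exact: (@cvgD _ _ _ _ tf _ _ _ _ (h p) (h q)).
apply/funext => J; rewrite /partial_sum -big_split /=; apply: eq_bigr => i _.
by rewrite mulrDl rscaleDr.
Qed.

Lemma lsm_real (r : R) : L (r%:A : quat R) = r *: (1 : bop H).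
Proof.
have [_ _ [I [e [[_ eb] he]]]] := hL; apply: bop_ext => x.
have tf := @totally_filter I.
apply: (cvg_unique _ (he r%:A (fun i => qdot (e i) x) x (eb x))) => //.
rewrite (_ : partial_sum _ = fun J => r *: partial_sum (fun i => e i ** qdot (e i) x) J).
  exact: (cvgZl_tmp (eb x)).
apply/funext => J; rewrite /partial_sum scaler_sumr; apply: eq_bigr => i _.
by rewrite -rscaleA rscale_real rscaleZl.
Qed.

Lemma lsmZ (r : R) q : L (r *: q) = r *: L q.
Proof. by rewrite -[r *: q]mul1r -scalerAr scalerAl lsmM lsm_real bop_scaleAl mul1r. Qed.

Lemma lsm_bounded : exists2 C, 0 <= C & forall q, `|L q| <= C * `|q|.
Proof.
pose i1 : quat R := Quat 0 1 0 0; pose i2 : quat R := Quat 0 0 1 0; pose i3 : quat R := Quat 0 0 0 1.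
exists (`|L 1| + `|L i1| + `|L i2| + `|L i3|); first by rewrite !addr_ge0.
move=> q; have [h0 h1 h2 h3] := qcomp_le_norm q.
rewrite {1}(quatE q) !lsmD !lsmZ !mulrDl.
rewrite (le_trans (ler_normD _ _))// lerD//; last by rewrite normrZ mulrC ler_wpM2l.
rewrite (le_trans (ler_normD _ _))// lerD//; last by rewrite normrZ mulrC ler_wpM2l.
rewrite (le_trans (ler_normD _ _))// lerD//; last by rewrite normrZ mulrC ler_wpM2l.
by rewrite normrZ mulrC ler_wpM2l.
Qed.

End LeftScalarMultiplication.

(** * Polarization for self-adjoint operators *)

Section HilbertNorm.
Context {R : realType} {H : qhilbertType R}.
Implicit Types x y : H.

Lemma sqr_normD x y : `|x + y| ^+ 2 = `|x| ^+ 2 + `|y| ^+ 2 + 2 * qre (qdot x y).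
Proof. by rewrite !sqr_normE qdotDl !qdotDr /= (qre_qdotC y x); ring. Qed.

Lemma qdotNr x y : qdot x (- y) = - qdot x y.
Proof. by apply: (addrI (qdot x y)); rewrite -qdotDr !subrr qdot0r. Qed.

Lemma qdotZr_real x y (r : R) : qdot x (r *: y) = r *: qdot x y.
Proof. by rewrite -rscale_real qdotZr -scalerAr mulr1. Qed.

Lemma sqr_normB x y : `|x - y| ^+ 2 = `|x| ^+ 2 + `|y| ^+ 2 - 2 * qre (qdot x y).
Proof. by rewrite sqr_normD normrN qdotNr /=; ring. Qed.

Lemma selfadjoint_polar (A : bop H) x y : selfadjoint A ->
  4 * qre (qdot x (A y)) =
  qre (qdot (x + y) (A (x + y))) - qre (qdot (x - y) (A (x - y))).
Proof.
move=> sA; have e : qre (qdot y (A x)) = qre (qdot x (A y)).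
  by rewrite qre_qdotC sA.
have dN (u v : H) : qre (qdot (- u) v) = - qre (qdot u v).
  by rewrite qre_qdotC qdotNr /= qre_qdotC.
by rewrite !bopD !bopN !qdotDl !qdotDr !qdotNr /= !dN e; ring.
Qed.

Lemma selfadjoint_real_shift (A : bop H) (r : R) :
  selfadjoint A -> selfadjoint (A - r *: (1 : bop H)).
Proof.
move=> sA x y; rewrite !bopE /= qdotDl qdotDr sA; congr (_ + _).
rewrite qdotNr qdotZr_real; apply: (addrI (qdot (r *: x) y)).
rewrite -qdotDl subrr (_ : qdot 0 y = 0); last by rewrite qdotC qdot0r; apply: quat_ext => /=; rewrite ?oppr0.
by rewrite qdotC qdotZr_real (qdotC x y); apply: quat_ext => /=; ring.
Qed.

End HilbertNorm.

(** * Calculus of projection-valued measures *)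

Lemma measurable_ocitv {R : realType} (a b : R) :
  measurable (`]a, b]%classic : set (measurableTypeR R)).
Proof. exact: measurable_itv. Qed.

Section ProjectionValuedMeasure.
Context {R : realType} {H : qhilbertType R} (E : pvm H).
Implicit Types (x y : H) (A B : set (measurableTypeR R)).

Lemma pvm_fin_num x : fin_num_fun (spectral_dist E x).
Proof. by []. Qed.
HB.instance Definition _ x := Measure_isFinite.Build _ _ _ (spectral_dist E x) (pvm_fin_num x).

Lemma pvm_adj B x y : measurable B -> qdot (E B x) y = qdot x (E B y).
Proof. by move=> mB; have [_ ->] := pvm_proj E mB. Qed.

Lemma pvm_idem B x : measurable B -> E B (E B x) = E B x.
Proof. by move=> mB; have [h _] := pvm_proj E mB; rewrite -[in RHS]h. Qed.

Lemma pvm_capE A B x : measurable A -> measurable B -> E A (E B x) = E (A `&` B) x.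
Proof. by move=> mA mB; rewrite pvmI. Qed.

Lemma pvmC A B x : measurable A -> measurable B -> E A (E B x) = E B (E A x).
Proof. by move=> mA mB; rewrite !pvm_capE// setIC. Qed.

Lemma pvm_disjoint A B x : measurable A -> measurable B -> A `&` B = set0 ->
  E A (E B x) = 0.
Proof.
by move=> mA mB AB; rewrite pvm_capE// AB pvm0.
Qed.

Lemma pvmU A B x : measurable A -> measurable B -> A `&` B = set0 ->
  E (A `|` B) x = E A x + E B x.
Proof.
move=> mA mB AB.
have mF n : measurable (bigcup2 A B n) by case: n => [|[|n]] /=.
have tF : trivIset setT (bigcup2 A B).
  by rewrite -trivIset_bigcup2.
have := @pvm_sigma_additive _ _ E _ mF tF x; rewrite bigcup2E => h.
rewrite -(@cvg_shiftn 2) in h.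
apply: (cvg_unique _ h) => //.
rewrite (_ : (fun n => _) = cst (E A x + E B x)); first exact: cvg_cst.
apply/funext => n; rewrite addn2 !big_nat_recl//= big1 ?addr0// => i _.
by rewrite pvm0.
Qed.

Lemma pvm_setC B x : measurable B -> E B x + E (~` B) x = x.
Proof.
move=> mB; rewrite -pvmU ?setUv ?pvmT// ?setICr//; exact: measurableC.
Qed.

Lemma pvm_sqr_normU A B x : measurable A -> measurable B -> A `&` B = set0 ->
  `|E (A `|` B) x| ^+ 2 = `|E A x| ^+ 2 + `|E B x| ^+ 2.
Proof.
move=> mA mB AB; have := measureU (spectral_dist E x) mA mB AB.
by rewrite /spectral_dist /= -EFinD => -[].
Qed.

Lemma pvm_norm_le B x : measurable B -> `|E B x| <= `|x|.
Proof.
move=> mB; rewrite -(@ler_pXn2r _ 2) ?nnegrE//.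
have := @pvm_sqr_normU B (~` B) x mB (measurableC mB).
by rewrite setICr setUv pvmT => -> //; rewrite lerDl sqr_ge0.
Qed.

Lemma pvm_norm B : measurable B -> `|E B| <= 1.
Proof. by move=> mB; apply: bop_norm_le => // x; rewrite mul1r pvm_norm_le. Qed.

Lemma pvm_null_bigcup (F : nat -> set (measurableTypeR R)) B x :
  (forall n, measurable (F n)) -> measurable B -> B `<=` \bigcup_n F n ->
  (forall n, E (F n) x = 0) -> E B x = 0.
Proof.
move=> mF mB BF F0.
have : spectral_dist E x B = 0%E.
  apply: measure_negligible => //; apply: (negligibleS BF).
  apply: negligible_bigcup => n; apply/negligibleP => //.
  by rewrite /= /spectral_dist F0 normr0 expr0n.
by move=> -[/eqP]; rewrite sqrf_eq0 normr_eq0 => /eqP.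
Qed.

Lemma pvm_eq0 x : (forall a b : R, a <= b -> E `]a, b]%classic x = 0) -> x = 0.
Proof.
move=> h; have <- : E setT x = x by rewrite pvmT.
apply: (@pvm_null_bigcup (fun n => `](- n%:R), n%:R]%classic)) => // [t _|n].
  have [n _ /(_ _ (leqnn n)) hn] := near_infty_natSinv_lt (PosNum (ltr01 (R := R))).
  exists (Num.bound `|t|).+1 => //=; rewrite in_itv /=.
  have := archi_boundP (normr_ge0 t); rewrite ltr_norml => /andP[h1 h2].
  have : (Num.bound `|t|)%:R <= (Num.bound `|t|).+1%:R :> R by rewrite ler_nat.
  by move=> ?; apply/andP; split; lra.
by apply: h; rewrite (@le_trans _ _ 0)// oppr_le0.
Qed.

End ProjectionValuedMeasure.

(** * Consequences of the weak formula for [T] as an integral against [E] *)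

Section SpectralMeasure.
Context {R : realType} {H : qhilbertType R} (T : bop H) (E : pvm H).
Hypothesis hT : selfadjoint T.
Hypothesis hE : is_spectral_measure T E.
Implicit Types (x y : H) (B : set (measurableTypeR R)).

Lemma spectral_form x : qre (qdot x (T x)) =
  (\int[spectral_dist E x]_(t in setT) (t : R)).
Proof. by have [_ ->] := hE x; rewrite /= mulr1. Qed.

(* For [x] and [y] in complementary spectral subspaces the measures of [x + y]
   and [x - y] coincide, so polarization gives [<x, T y> = 0]. *)
Lemma spectral_cross B x y : measurable B ->
  qre (qdot (E (~` B) x) (T (E B y))) = 0.
Proof.
move=> mB; have mC := measurableC mB.
set u := E (~` B) x; set v := E B y.
suff : 4 * qre (qdot u (T v)) = 0 by lra.
rewrite selfadjoint_polar// !spectral_form /Rintegral.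
rewrite (@eq_measure_integral _ _ _ _ (spectral_dist E (u - v))) ?subrr//.
move=> C mC' _; rewrite /= /spectral_dist bopD bopB sqr_normD sqr_normB.
suff -> : qdot (E C u) (E C v) = 0 by rewrite /= mulr0 addr0 subr0.
rewrite /u /v pvm_adj// pvm_idem// pvm_adj// (pvmC E _ mC')// (pvm_disjoint E _ mC)//.
  by rewrite qdot0r.
by rewrite setICl.
Qed.

(** Taking [x = T (E B y)] in [spectral_cross] turns the inner product into the squared norm of the
    vector to be killed, so the vanishing of a real part suffices. *)
Lemma spectral_invariant B y : measurable B -> E (~` B) (T (E B y)) = 0.
Proof.
move=> mB; have mC := measurableC mB.
apply/eqP; rewrite -normr_eq0 -sqrf_eq0 sqr_normE pvm_adj// pvm_idem//.
rewrite qre_qdotC; have := spectral_cross (T (E B y)) y mB.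
by rewrite pvm_adj// qre_qdotC pvm_adj// => <-; rewrite qre_qdotC.
Qed.

(** The ranges of [E B] and of the complementary projection are both invariant, so [T] is block
    diagonal. *)
Lemma spectral_comm B : measurable B -> T * E B = E B * T.
Proof.
move=> mB; have mC := measurableC mB; apply: bop_ext => x; rewrite !bopE.
have h1 : T (E B x) = E B (T (E B x)).
  by rewrite -{1}(pvm_setC E (T (E B x)) mB) spectral_invariant// addr0.
have h2 : E B (T (E (~` B) x)) = 0.
  by have := spectral_invariant x mC; rewrite setCK.
by rewrite -[in RHS](pvm_setC E x mB) bopD bopD h2 addr0.
Qed.

(** The scalar measure of such an [x] vanishes off []a, b]] and has total mass [|x|^2]. *)
Lemma spectral_form_bound (a b : R) x : E `]a, b]%classic x = x ->
  a * `|x| ^+ 2 <= qre (qdot x (T x)) <= b * `|x| ^+ 2.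
Proof.
set B := (`]a, b]%classic : set (measurableTypeR R)) => Bx.
have mB : measurable B by exact: measurable_ocitv.
have mC := measurableC mB.
have [intT _] := hE x.
have C0 : spectral_dist E x (~` B) = 0%E.
  by rewrite /spectral_dist -Bx pvm_disjoint ?setICl// normr0 expr0n.
have -> : qre (qdot x (T x)) = \int[spectral_dist E x]_(t in B) (t : R).
  rewrite spectral_form /Rintegral; congr fine.
  by rewrite (negligible_integral mC measurableT intT C0) setTD setCK.
have intB : (spectral_dist E x).-integrable B (EFin : measurableTypeR R -> \bar R).
  exact: integrableS intT.
have c (r : R) : r * `|x| ^+ 2 = \int[spectral_dist E x]_(t in B) r.
  by rewrite Rintegral_cst//= /spectral_dist /= Bx.
rewrite !c; apply/andP; split; apply: le_Rintegral => //.
- exact: finite_measure_integrable_cst.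
- by move=> t; rewrite /B /= in_itv /= => /andP[/ltW].
- exact: finite_measure_integrable_cst.
- by move=> t; rewrite /B /= in_itv /= => /andP[].
Qed.

(** On the range of [E ]a, b]] the quadratic form of [T - t] is at most [b - a], and the norm of a
    self-adjoint operator is controlled by its quadratic form. The range is invariant, so
    [(T - t) x] may serve as a test vector. *)
Lemma spectral_norm_bound (a b t : R) x : a <= t -> t <= b ->
  E `]a, b]%classic x = x -> `|T x - t *: x| <= (b - a) * `|x|.
Proof.
move=> at_ tb Ex; set B := (`]a, b]%classic : set (measurableTypeR R)) in Ex *.
have mB : measurable B by exact: measurable_ocitv.
pose S := T - t *: (1 : bop H); have sS := selfadjoint_real_shift t hT.
have form z : E B z = z -> `|qre (qdot z (S z))| <= (b - a) * `|z| ^+ 2.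
  move=> Ez; have /andP[h1 h2] := spectral_form_bound Ez.
  have -> : qre (qdot z (S z)) = qre (qdot z (T z)) - t * `|z| ^+ 2.
    by rewrite /S !bopE qdotDr qdotNr qdotZr_real /= sqr_normE.
  have z0 := sqr_ge0 `|z|.
  have g1 : a * `|z| ^+ 2 <= t * `|z| ^+ 2 by rewrite ler_wpM2r.
  have g2 : t * `|z| ^+ 2 <= b * `|z| ^+ 2 by rewrite ler_wpM2r.
  by rewrite ler_norml mulrBl; apply/andP; split; lra.
have -> : T x - t *: x = S x by [].
have [->|x0] := eqVneq x 0; first by rewrite bop_at0 normr0 mulr0.
have [->|y0] := eqVneq (S x) 0; first by rewrite normr0 mulr_ge0// subr_ge0 (le_trans at_).
have ESx : E B (S x) = S x.
  rewrite /S !bopE bopB bopZ Ex; congr (_ - _).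
  by have /(congr1 (fun A : bop H => A x)) := spectral_comm mB; rewrite !bopE Ex.
have nx : 0 < `|x| by rewrite normr_gt0.
have ny : 0 < `|S x| by rewrite normr_gt0.
(* Giving [w] the length of [x] makes the polarized sum exactly [4 * |x|^2] by the parallelogram
   law, so that no constant is lost. *)
pose r := `|x| / `|S x|; pose w := r *: S x.
have r0 : 0 <= r by rewrite divr_ge0.
have nw : `|w| = `|x| by rewrite normrZ ger0_norm// /r divfK// gt_eqF.
have Ew : E B w = w by rewrite /w bopZ ESx.
have key : qre (qdot w (S x)) = `|x| * `|S x|.
  rewrite qre_qdotC /w qdotZr_real /= -sqr_normE /r expr2 mulrA divfK// gt_eqF//.
have := selfadjoint_polar w x sS; rewrite -/S key => polar.
have := form (w + x); rewrite bopD Ew Ex => /(_ erefl); rewrite sqr_normD ler_norml => /andP[_ f1].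
have := form (w - x); rewrite bopB Ew Ex => /(_ erefl); rewrite sqr_normB ler_norml => /andP[f2 _].
have : 4 * (`|x| * `|S x|) <= 4 * (`|x| * ((b - a) * `|x|)).
  rewrite polar; rewrite nw in f1 f2; move: f1 f2.
  move: (qre (qdot (w + x) _)) (qre (qdot (w - x) _)) (qre (qdot w x)) `|x|.
  by move=> q1 q2 q3 n h1 h2; rewrite expr2 in h1 h2; lra.
by rewrite ler_pM2l// ler_pM2l.
Qed.

Lemma spectral_local_norm (a b t : R) : a <= t -> t <= b ->
  `|E `]a, b]%classic * (T - t *: (1 : bop H))| <= b - a.
Proof.
move=> at_ tb; have mB : measurable (`]a, b]%classic : set (measurableTypeR R)) by exact: measurable_ocitv.
apply: bop_norm_le => [|x]; first by rewrite subr_ge0 (le_trans at_).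
have ba : 0 <= b - a by rewrite subr_ge0 (le_trans at_).
rewrite mulrBr -spectral_comm// bop_scaleAr mulr1 !bopE.
rewrite (le_trans (spectral_norm_bound at_ tb _))//; first exact: pvm_idem.
by rewrite ler_wpM2l// pvm_norm_le.
Qed.

Lemma Qop_real (t : R) : Qop (t%:A : quat R) T = (T - t *: (1 : bop H)) * (T - t *: (1 : bop H)).
Proof.
rewrite /Qop qnormr -normrX ger0_norm ?sqr_ge0// /= mulr1 expr2.
rewrite mulrBl !mulrBr bop_scaleAr bop_scaleAl mulr1 mul1r bop_scaleAl mul1r scalerA.
by rewrite -expr2 opprB addrA mulr_natl mulr2n scalerDl opprD !addrA addrAC.
Qed.

Definition real_spectrum : set R := [set t | S_spectrum T t%:A].

(** At a real [t], [Qop] is the square of [S = T - t]. On the range of [E ]a, b]] the norm of [S] is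
    at most [b - a], which contradicts the invertibility of the square on a short interval unless
    that range is zero. *)
Lemma pvm_off_spectrum (t : R) : ~ real_spectrum t -> exists2 d, 0 < d &
  forall a b, a <= t -> t <= b -> b - a < d -> E `]a, b]%classic = 0.
Proof.
move=> /contrapT; rewrite Qop_real => /bop_invP; set B := bop_inv _ => -[_ BS].
have n0 : 0 < `|B| + 1 by rewrite ltr_wpDl.
(* The bound 1 disposes of one of the two factors [b - a]; the second bound makes [|B| * (b - a)]
   less than 1. *)
exists (Num.min 1 (`|B| + 1)^-1) => [|a b at_ tb].
  by rewrite lt_min ltr01 invr_gt0.
rewrite lt_min => /andP[ba1 baB].
have ba : 0 <= b - a by rewrite subr_ge0 (le_trans at_).
set P := E `]a, b]%classic; set S := T - t *: (1 : bop H).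
have mI : measurable (`]a, b]%classic : set (measurableTypeR R)) by exact: measurable_ocitv.
have PS : P * S = S * P.
  by rewrite mulrBr mulrBl -spectral_comm// bop_scaleAr bop_scaleAl mulr1 mul1r.
have PP : P * P = P by have [] := pvm_proj E mI.
have hP : `|P * S| <= b - a by exact: spectral_local_norm.
have PE : P = B * (P * S) * (P * S) * P.
  have -> : B * (P * S) * (P * S) * P = B * (S * S) * P.
    by rewrite PS -!mulrA (mulrA P S) PS -!mulrA !PP.
  by rewrite BS mul1r.
have : `|P| <= `|B| * (b - a) * `|P|.
  rewrite {1}PE (le_trans (bop_normM _ _))// ler_wpM2r//.
  rewrite (le_trans (bop_normM _ _))//.
  rewrite ler_pM// (le_trans (bop_normM _ _))// ler_piMr//.
  by rewrite (le_trans hP)// ltW.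
rewrite -{1}[`|P|]mul1r -subr_le0 -mulrBl pmulr_rle0; last first.
  rewrite subr_gt0; apply: (@le_lt_trans _ _ (`|B| * (`|B| + 1)^-1)).
    by rewrite ler_wpM2l// ltW.
  by rewrite ltr_pdivrMr// mul1r ltrDl.
by rewrite normr_le0 => /eqP.
Qed.

End SpectralMeasure.

(** * Dependence of [Qop s T] and its inverse on [s] *)

Section Resolvent.
Context {R : realType} {H : qhilbertType R} (T : bop H).
Implicit Types (s : quat R) (A B : bop H).

Lemma qnormB_real (s : quat R) (t : R) :
  `|s - t%:A| ^+ 2 = `|s| ^+ 2 - 2 * qre s * t + t ^+ 2.
Proof. by rewrite !qsqnormE /qsqnorm /=; ring. Qed.

(** Division of the polynomial [X^2 - 2 Re(s) X + |s|^2] by [X - t]: the remainder is its value at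
    [t], which is [|s - t|^2] because [t] is real. *)
Lemma Qop_shift s (t : R) : Qop s T =
  (T - t *: (1 : bop H)) * (T + (t - 2 * qre s) *: (1 : bop H)) +
  (`|s - t%:A| ^+ 2) *: (1 : bop H).
Proof.
set c := t - _; rewrite /Qop expr2 mulrBl !mulrDr !bop_scaleAl !bop_scaleAr !mul1r !mulr1 scalerA.
rewrite opprD !addrA -[in RHS](addrA (T * T)) -scalerBl -[RHS]addrA [in RHS](addrC (- _)) -scalerBl.
rewrite -scaleNr; congr (_ + _ *: _ + _ *: _); rewrite ?qnormB_real /c; ring.
Qed.

Lemma Qop_diff_norm s s' : `|Qop s' T - Qop s T| <=
  `|s' - s| * (2 * `|T| + `|s'| + `|s|).
Proof.
have -> : Qop s' T - Qop s T = (2 * (qre s - qre s')) *: T + (`|s'| ^+ 2 - `|s| ^+ 2) *: (1 : bop H).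
  rewrite /Qop mulrBr !scalerBl opprD opprB addrACA; congr (_ + _).
  by rewrite addrC -addrA addKr.
rewrite (le_trans (ler_normD _ _))// -addrA [leRHS]mulrDr lerD//.
  rewrite normrZ normrM (ger0_norm (ler0n _ 2)) [leRHS]mulrCA -mulrA.
  rewrite ler_wpM2l// ler_wpM2r//.
  by have [h _ _ _] := qcomp_le_norm (s - s'); rewrite [leRHS]distrC.
rewrite normrZ subr_sqr normrM (@ger0_norm _ (`|s'| + `|s|)) ?addr_ge0// (le_trans (_ : _ <= `| `|s'| - `|s| | * (`|s'| + `|s|)))//.
  by rewrite ler_piMr ?mulr_ge0// ?addr_ge0// bop_norm1.
by rewrite ler_wpM2r ?addr_ge0// ler_dist_dist.
Qed.

Lemma resolvent_identity s s' : invertible (Qop s T) -> invertible (Qop s' T) ->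
  bop_inv (Qop s T) - bop_inv (Qop s' T) =
  bop_inv (Qop s T) * (Qop s' T - Qop s T) * bop_inv (Qop s' T).
Proof.
move=> /bop_invP[_ h1] /bop_invP[h2 _].
by rewrite mulrBr mulrBl h1 mul1r -mulrA h2 mulr1.
Qed.

(** The resolvent identity bounds the second inverse by the first plus half of the second, and that
    half is absorbed on the left. *)
Lemma resolvent_norm_le s s' : invertible (Qop s T) -> invertible (Qop s' T) ->
  `|bop_inv (Qop s T)| * `|Qop s' T - Qop s T| <= 2^-1 ->
  `|bop_inv (Qop s' T)| <= 2 * `|bop_inv (Qop s T)|.
Proof.
move=> i1 i2 h; have := resolvent_identity i1 i2.
set B := bop_inv _ in h *; set B' := bop_inv (Qop s' T) => e.
have : `|B'| <= `|B| + 2^-1 * `|B'|.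
  have := ler_normB B (B - B'); rewrite subKr => /le_trans; apply.
  rewrite lerD// e.
  rewrite (le_trans (bop_normM _ _))// ler_wpM2r// (le_trans _ h)//.
  exact: bop_normM.
by move: `|B'| `|B| => x y; lra.
Qed.

Lemma resolvent_set_open (t : R) : invertible (Qop (t%:A : quat R) T) ->
  exists2 d, 0 < d & forall t', `|t' - t| < d -> invertible (Qop (t'%:A : quat R) T).
Proof.
move=> it; set B := bop_inv (Qop t%:A T).
pose C := 2 * `|T| + (`|t| + 1) + `|t|.
have C0 : 0 < C by rewrite /C ltr_wpDr// ltr_wpDl ?mulr_ge0// ltr_wpDl.
have BC : 0 < `|B| * C + 1 by rewrite ltr_wpDl// mulr_ge0// ltW.
exists (Num.min 1 (`|B| * C + 1)^-1) => [|t']; first by rewrite lt_min ltr01 invr_gt0.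
rewrite lt_min => /andP[t1 tB].
rewrite -[Qop t'%:A T](subrK (Qop t%:A T)) addrC; apply: invertible_perturb => //.
rewrite -/B (@le_lt_trans _ _ (`|B| * (`|t' - t| * C)))//.
  rewrite ler_wpM2l// (le_trans (Qop_diff_norm _ _))// -scalerBl !qnormr ler_wpM2l//.
  rewrite /C lerD2r lerD2l.
  have -> : t' = t + (t' - t) by rewrite addrC subrK.
  by rewrite (le_trans (ler_normD _ _))// lerD2l ltW.
rewrite (@le_lt_trans _ _ ((`|B| * C + 1)^-1 * (`|B| * C)))//.
  by rewrite mulrCA ler_wpM2r ?mulr_ge0// ltW.
by rewrite mulrC ltr_pdivrMr// mul1r ltrDl.
Qed.

Lemma open_resolvent_set : open (~` real_spectrum T).
Proof.
rewrite openE => t /contrapT /resolvent_set_open[d d0 hd].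
by exists d => //= t' /= tt'; apply: contrapT => /contrapT; apply; apply: hd; rewrite distrC.
Qed.

End Resolvent.

(** * The spectral measure vanishes off the spectrum *)

Section SpectralSupport.
Context {R : realType} {H : qhilbertType R} (T : bop H) (E : pvm H).
Hypothesis hT : selfadjoint T.
Hypothesis hE : is_spectral_measure T E.

Lemma open_measurableTypeR (A : set R) : open A ->
  measurable (A : set (measurableTypeR R)).
Proof. by move=> /open_measurable mA; exact: mA. Qed.

Lemma measurable_resolvent_set :
  measurable (~` real_spectrum T : set (measurableTypeR R)).
Proof. by have h := open_measurableTypeR (@open_resolvent_set R H T); exact: h. Qed.

(** Each resolvent point lies in a null interval with rational ends, and these are countably many.
    [F] enumerates all pairs of rationals and puts the empty set for an interval that does not
    annihilate [x]. *)
Lemma pvm_resolvent_set x : E (~` real_spectrum T) x = 0.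
Proof.
pose F (k : nat) : set (measurableTypeR R) :=
  if (unpickle k : option (rat * rat)) is Some (p, q) then
    (if `[< E `](ratr p), (ratr q)]%classic x = 0 >] then `](ratr p), (ratr q)]%classic else set0)
  else set0.
apply: (@pvm_null_bigcup _ _ E F) => [k||t ht|k].
- rewrite /F; case: unpickle => [[p q]|//]; case: ifP => // _.
- by have h := @measurable_resolvent_set; exact: h.
- have [d d0 hd] := pvm_off_spectrum hT hE ht.
  have [p hp] : exists q, ratr q \in `](t - d / 2), t[ by apply: rat_in_itvoo; lra.
  have [q hq] : exists q, ratr q \in `]t, (t + d / 2)[ by apply: rat_in_itvoo; lra.
  move: hp hq; rewrite !in_itv /= => /andP[p1 p2] /andP[q1 q2].
  exists (pickle (p, q)); first exact: Logic.I.
  have E0 : E `](ratr p), (ratr q)]%classic x = 0 by rewrite hd//; lra.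
  by rewrite /F pickleK asboolT//= in_itv /= p2 ltW.
- rewrite /F; case: unpickle => [[p q]|]; last exact: pvm0.
  by case: asboolP => // _; exact: pvm0.
Qed.

End SpectralSupport.

(** * Uniform estimates along a continuous curve *)

Section Curves.
Context {R : realType} (g : R -> quat R).
Hypothesis gc : {within `[0, 1], continuous g}.

Lemma curve_continuous (t e : R) : 0 <= t <= 1 -> 0 < e -> exists2 d, 0 < d &
  forall s, 0 <= s <= 1 -> `|s - t| < d -> `|g s - g t| < e.
Proof.
move=> t01 e0; move/subspace_continuousP : gc => /(_ t).
rewrite /= in_itv /= => /(_ t01)/cvgrPdist_lt/(_ e e0)/nbhs_ballP[d /= d0 hd]; exists d => // s s01 st.
have := hd s; rewrite -ball_normE /= distrC => /(_ st).
by rewrite in_itv /= => /(_ s01); rewrite distrC.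
Qed.

Lemma curve_unif_continuous (e : R) : 0 < e -> exists2 d, 0 < d &
  forall s t, 0 <= s <= 1 -> 0 <= t <= 1 -> `|s - t| < d -> `|g s - g t| < e.
Proof.
move=> e0.
(* The repeated condition matches [P 0 1] below. In [P a b] only [s] is confined to [[a, b]] while
   [t] runs through [[0, 1]]: otherwise pairs on two sides of a junction would be lost when
   intervals are joined. *)
suff [d d0 hd] : exists2 d, 0 < d & forall s t, 0 <= s <= 1 -> 0 <= s <= 1 ->
    0 <= t <= 1 -> `|s - t| < d -> `|g s - g t| < e.
  by exists d => // s t s01 t01; exact: hd.
pose P (a b : R) := exists2 d, 0 < d & forall s t, a <= s <= b -> 0 <= s <= 1 ->
    0 <= t <= 1 -> `|s - t| < d -> `|g s - g t| < e.
apply: (@cousin _ P 0 1) => // [x y z xy yz [d d0 hd] [d' d'0 hd']|t t01].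
  exists (Num.min d d') => [|s t /andP[s1 s2] s01 t01]; first by rewrite lt_min d0.
  rewrite lt_min => /andP[h1 h2].
  have [sy|ys] := leP s y; first by apply: hd; rewrite ?s1.
  by apply: hd'; rewrite ?(ltW ys).
have e2 : 0 < e / 2 by rewrite divr_gt0.
have [d d0 hd] := curve_continuous t01 e2.
exists (d / 2) => [|x y xt ty yx]; first by rewrite divr_gt0.
exists (d / 2) => [|s s' /andP[s1 s2] s01 s'01 ss']; first by rewrite divr_gt0.
have h1 : `|g s - g t| < e / 2.
  by apply: hd => //; rewrite ltr_norml; apply/andP; split; lra.
have h2 : `|g s' - g t| < e / 2.
  apply: hd => //; move: ss'; rewrite !ltr_norml => /andP[? ?].
  by apply/andP; split; lra.
rewrite (_ : g s - g s' = (g s - g t) - (g s' - g t)); last by rewrite opprB addrA subrK.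
by rewrite (le_lt_trans (ler_normB _ _))//; lra.
Qed.

(** Stated for a locally bounded [phi], since for the norm of the resolvent along a curve local
    bounds come before any continuity. *)
Lemma bounded_along (phi : R -> R) :
  (forall t, 0 <= t <= 1 -> exists2 d, 0 < d & exists K,
     forall s, 0 <= s <= 1 -> `|s - t| < d -> phi s <= K) ->
  exists K, forall t, 0 <= t <= 1 -> phi t <= K.
Proof.
move=> loc; pose P (a b : R) := exists K, forall t, a <= t <= b -> 0 <= t <= 1 -> phi t <= K.
have [K hK] : P 0 1; last by exists K => t t01; exact: hK.
apply: cousin => // [x y z xy yz [K hK] [K' hK']|t t01].
  exists (Num.max K K') => t /andP[t1 t2] t01; rewrite le_max.
  have [ty|yt] := leP t y; first by rewrite hK// t1.
  by rewrite hK' ?orbT// (ltW yt).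
have [d d0 [K hK]] := loc t t01; exists d => // x y xt ty yx.
exists K => s /andP[s1 s2] s01; apply: hK => //.
by rewrite ltr_norml; apply/andP; split; lra.
Qed.

Lemma curve_bounded : exists m, forall t, 0 <= t <= 1 -> `|g t| <= m.
Proof.
apply: bounded_along => t t01; have [d d0 hd] := curve_continuous t01 ltr01.
exists d => //; exists (`|g t| + 1) => s s01 st.
rewrite -[g s](subrK (g t)) addrC (le_trans (ler_normD _ _))// lerD2l ltW//.
exact: hd.
Qed.

Lemma qnormV (x : quat R) : x != 0 -> `|x^-1| = `|x|^-1.
Proof.
move=> x0; have ux : x \is a GRing.unit by [].
apply: (mulfI (_ : `|x| != 0)); first by rewrite normr_eq0.
by rewrite -qnormM mulrV// divff ?normr_eq0// -(scale1r 1) qnormr normr1.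
Qed.

Lemma curve_inv_bounded (z : quat R) : (forall t, 0 <= t <= 1 -> g t != z) ->
  exists K, forall t, 0 <= t <= 1 -> `|(g t - z)^-1| <= K.
Proof.
move=> gz; apply: bounded_along => t t01.
have n0 : 0 < `|g t - z| by rewrite normr_gt0 subr_eq0 gz.
have n2 : 0 < `|g t - z| / 2 by rewrite divr_gt0.
have [d d0 hd] := curve_continuous t01 n2.
exists d => //; exists (`|g t - z| / 2)^-1 => s s01 st.
have h : `|g t - z| / 2 <= `|g s - z|.
  have := hd s s01 st; have := ler_normB (g s - z) (g s - g t).
  rewrite opprB [_ + (g t - g s)]addrC subrKA.
  by move: `|g t - z| `|g s - z| `|g s - g t| => x y w; lra.
have s0 : g s - z != 0 by rewrite subr_eq0 gz.
by rewrite qnormV// lef_pV2 ?posrE// normr_gt0.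
Qed.

Lemma lipschitz_along (V : normedModType R) (f : quat R -> quat R -> V) (C : R) :
  0 <= C -> (forall s t, 0 <= s <= 1 -> 0 <= t <= 1 -> forall h,
    `|f (g s) h - f (g t) h| <= C * `|g s - g t| * `|h|) ->
  unif_continuous_along g f.
Proof.
move=> C0 fC e e0; have C1 : 0 < C + 1 by rewrite ltr_wpDl.
have [d d0 hd] := curve_unif_continuous (divr_gt0 e0 C1).
exists d => // s t s01 t01 st h; rewrite (le_trans (fC _ _ s01 t01 h))//.
rewrite ler_wpM2r// (@le_trans _ _ (C * (e / (C + 1))))//.
  by rewrite ler_wpM2l// ltW// hd.
by rewrite mulrCA ler_piMr// ?ltW// ltr_pdivrMr// mul1r ltrDl.
Qed.

End Curves.

(** * Existence of the integrals of the resolvent and of the Cauchy kernel *)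

Section ResolventAlongCurve.
Context {R : realType} {H : qhilbertType R} (T : bop H) (L : quat R -> bop H).
Hypothesis hL : left_scalar_mult L.
Variables (I : quat R) (g : R -> quat R).
Hypothesis hI : imag_unit I.
Hypothesis gc : {within `[0, 1], continuous g}.
Hypothesis gr : rectifiable g.
Hypothesis gT : forall t, 0 <= t <= 1 -> invertible (Qop (g t) T).

Lemma resolvent_bounded : exists2 r, 0 <= r &
  forall t, 0 <= t <= 1 -> `|bop_inv (Qop (g t) T)| <= r.
Proof.
suff [K hK] : exists K, forall t, 0 <= t <= 1 -> `|bop_inv (Qop (g t) T)| <= K.
  by exists K => //; rewrite (le_trans _ (hK 0 _))// lexx ler01.
have [m hm] := curve_bounded gc.
apply: bounded_along => t t01; set r := `|bop_inv (Qop (g t) T)|.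
have m0 : 0 <= m by rewrite (le_trans _ (hm t t01)).
pose c := 2 * `|T| + m + m.
have c0 : 0 <= c by rewrite !addr_ge0// mulr_ge0.
have r0 : 0 <= r by exact: normr_ge0.
have rc1 : 0 < r * c + 1 by rewrite ltr_wpDl// mulr_ge0.
(* [Qop] varies by at most [c] times the displacement, so this displacement keeps [r] times the
   variation below one half, as [resolvent_norm_le] requires; the added 1 covers [r * c = 0]. *)
have rc : 0 < (2 * (r * c + 1))^-1 by rewrite invr_gt0 mulr_gt0.
have [d d0 hd] := curve_continuous gc t01 rc.
exists d => //.
exists (2 * r) => s s01 st; apply: resolvent_norm_le; [exact: gT|exact: gT|].
rewrite -/r (@le_trans _ _ (r * ((2 * (r * c + 1))^-1 * c)))//.
  rewrite ler_wpM2l// (le_trans (Qop_diff_norm _ _ _))// ler_pM ?addr_ge0 ?mulr_ge0//.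
  - by apply: ltW; apply: hd.
  - by rewrite /c lerD ?hm// lerD2l hm.
rewrite mulrCA invfM -mulrA ler_piMr ?invr_ge0// ler_pdivrMl//.
by rewrite mulr1 lerDl.
Qed.

Let omega s ds := left_S_resolvent L s T * L (- I * ds).

Lemma norm_lsm_turn (C : R) (h : quat R) : (forall q, `|L q| <= C * `|q|) ->
  `|L (- I * h)| <= C * `|h|.
Proof.
by move=> hC; rewrite (le_trans (hC _))// qnormM (normrN I) (norm_imag_unit hI) mul1r.
Qed.

Lemma mulr_diff (V : pzRingType) (a b x y z : V) :
  - (a * (z - x)) - - (b * (z - y)) = - ((a - b) * (z - x)) + b * (x - y).
Proof.
have -> : x - y = (z - y) - (z - x) by rewrite opprB [RHS]addrC subrKA.
move: (z - x) (z - y) => u v.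
by rewrite opprK mulrBl opprB mulrBr [RHS]addrC subrKA addrC.
Qed.

Lemma qconjD (x y : quat R) : qconj (x - y) = qconj x - qconj y.
Proof. by apply: quat_ext => /=; ring. Qed.

Lemma lsmN q : L (- q) = - L q.
Proof. by rewrite -scaleN1r (lsmZ hL) scaleN1r. Qed.

Lemma resolvent_line_integral : is_line_integral g omega (line_integral g omega).
Proof.
have [r r0 hr] := resolvent_bounded; have [m hm] := curve_bounded gc.
have [C C0 hC] := lsm_bounded hL.
have m0 : 0 <= m by rewrite (le_trans _ (hm 0 _))// lexx ler01.
(* A Lipschitz constant for the resolvent, by the product rule: the first term varies the inverse of
   [Qop] through the resolvent identity, the second varies [L (qconj s)]. *)
pose K := r * (2 * `|T| + m + m) * r * (`|T| + C * m) + r * C.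
have K0 : 0 <= K by rewrite /K !(addr_ge0, mulr_ge0).
apply: line_integralP => //.
  by move=> s h h'; rewrite /omega mulrDr (lsmD hL) mulrDr.
apply: (lipschitz_along gc (C := K * C)) => [|s t s01 t01 h]; first by rewrite mulr_ge0.
rewrite /omega -mulrBl (le_trans (bop_normM _ _))//.
have dF : `|left_S_resolvent L (g s) T - left_S_resolvent L (g t) T| <= K * `|g s - g t|.
  rewrite /left_S_resolvent; set A := bop_inv (Qop (g s) T); set B := bop_inv (Qop (g t) T).
  have -> : - (A * (T - L (qconj (g s)))) - - (B * (T - L (qconj (g t)))) =
      - ((A - B) * (T - L (qconj (g s)))) + B * L (qconj (g s - g t)).
    by rewrite qconjD (lsmD hL) lsmN mulr_diff.
  rewrite (le_trans (ler_normD _ _))// normrN /K [leRHS]mulrDl lerD//.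
    rewrite (le_trans (bop_normM _ _))// mulrAC ler_pM//.
      rewrite resolvent_identity; [|exact: gT|exact: gT].
      rewrite (le_trans (bop_normM _ _))// mulrAC ler_pM//; last exact: hr.
      rewrite (le_trans (bop_normM _ _))// -mulrA ler_pM//; first exact: hr.
      rewrite mulrC distrC (le_trans (Qop_diff_norm _ _ _))// ler_wpM2l//.
      by rewrite lerD ?hm// lerD2l hm.
    rewrite (le_trans (ler_normB _ _))// lerD2l (le_trans (hC _))// ler_wpM2l//.
    by rewrite qnorm_conj hm.
  rewrite (le_trans (bop_normM _ _))// -mulrA ler_pM//; first exact: hr.
  by rewrite (le_trans (hC _))// qnorm_conj.
rewrite (le_trans (ler_pM _ _ dF (norm_lsm_turn _ hC)))//.
by rewrite mulrACA mulrA.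
Qed.

Lemma cauchy_line_integral (z : quat R) : (forall t, 0 <= t <= 1 -> g t != z) ->
  is_line_integral g (fun s ds => (s - z)^-1 * (- I * ds))
    (line_integral g (fun s ds => (s - z)^-1 * (- I * ds))).
Proof.
move=> gz; have [K hK] := curve_inv_bounded gc gz.
have K0 : 0 <= K by rewrite (le_trans _ (hK 0 _))// lexx ler01.
apply: line_integralP => //; first by move=> s h h'; rewrite !mulrDr.
apply: (lipschitz_along gc (C := K * K)) => [|s t s01 t01 h]; first by rewrite mulr_ge0.
have us : g s - z != 0 by rewrite subr_eq0 gz.
have ut : g t - z != 0 by rewrite subr_eq0 gz.
have e : (g s - z)^-1 - (g t - z)^-1 = (g s - z)^-1 * (g t - g s) * (g t - z)^-1.
  have -> : g t - g s = (g t - z) - (g s - z) by rewrite opprB addrA subrK.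
  by rewrite mulrBr mulVr// mulrBl mul1r -mulrA mulrV// mulr1.
rewrite -mulrBl qnormM qnormM (normrN I) (norm_imag_unit hI) mul1r ler_wpM2r//.
rewrite e !qnormM mulrAC distrC ler_wpM2r//.
by rewrite ler_pM// hK.
Qed.

End ResolventAlongCurve.

(** * Comparison of the resolvent with the Cauchy kernel near a real point *)

Section LocalEstimate.
Context {R : realType} {H : qhilbertType R} (T : bop H) (E : pvm H).
Hypothesis hT : selfadjoint T.
Hypothesis hE : is_spectral_measure T E.
Variable L : quat R -> bop H.
Hypothesis hL : left_scalar_mult L.

Lemma qconj_inv (x : quat R) : x != 0 -> x^-1 = (`|x| ^- 2) *: qconj x.
Proof. by rewrite qsqnormE. Qed.

Lemma comm_bop_inv (A B : bop H) : invertible A -> A * B = B * A ->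
  bop_inv A * B = B * bop_inv A.
Proof.
move=> /bop_invP[h1 h2] AB.
by rewrite -[in LHS](mulr1 B) -h1 (mulrA B) -AB -(mulrA A) mulrA h2 mul1r.
Qed.

(* With [k = |s - t|^-2], which is the value at [t] of the function whose value
   at [T] is [Q_s(T)^-1], factor [T - t] out of [Q_s(T)^-1 - k]. *)
Lemma resolvent_diff s (t : R) : s != t%:A -> invertible (Qop s T) ->
  left_S_resolvent L s T - L (s - t%:A)^-1 =
  `|s - t%:A| ^- 2 *: ((T - t *: (1 : bop H)) *
    (bop_inv (Qop s T) * (T + (t - 2 * qre s) *: (1 : bop H)) * (T - L (qconj s)) - 1)).
Proof.
move=> st is_; set k := _ ^- 2; set A := bop_inv _.
set W := T + (t - _) *: (1 : bop H).
set S := T - t *: (1 : bop H).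
have k0 : k != 0 by rewrite invr_neq0// expf_neq0// normr_eq0 subr_eq0.
have TS : Qop s T * S = S * Qop s T.
  have cT (B C : bop H) : B * T = T * B -> C * T = T * C -> (B * C) * T = T * (B * C).
    by move=> h1 h2; rewrite -mulrA h2 mulrA h1 mulrA.
  have QT : Qop s T * T = T * Qop s T.
    rewrite /Qop expr2 mulrDl mulrBl mulrDr mulrBr !bop_scaleAl !bop_scaleAr.
    by rewrite mul1r mulr1 mulrA.
  by rewrite /S mulrBr mulrBl bop_scaleAr bop_scaleAl mulr1 mul1r QT.
have AS : A * S = S * A by exact: comm_bop_inv.
have [_ h2] := bop_invP is_; rewrite -/A in h2.
have QE : Qop s T = S * W + k^-1 *: (1 : bop H).
  by rewrite (Qop_shift T s t) /k invrK.
have SE : T = S + t *: (1 : bop H) by rewrite subrK.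
rewrite qconj_inv ?subr_eq0// (lsmZ hL) qconjD (lsmD hL).
rewrite (_ : qconj t%:A = t%:A); last by apply: quat_ext => /=; ring.
rewrite (lsmN hL) (lsm_real hL) -/k /left_S_resolvent -/A.
set Y := L (qconj s).
clearbody S W A Y k.
(* This is the division [Qop s T = S * W + k^-1] multiplied by the inverse [A]. With [Z = T - Y],
   the difference [Z - S] is then [t - Y], whose multiple by [- k] is [L] of [(s - t)^-1]. *)
have SAW : S * (A * W) = 1 - k^-1 *: A.
  have e : A * (S * W) + k^-1 *: A = 1 by rewrite -[RHS]h2 QE mulrDr bop_scaleAr mulr1.
  by rewrite mulrA -AS -mulrA -e addrK.
have ZS : T - Y - S = - (Y - t *: (1 : bop H)).
  by rewrite {1}SE opprB addrAC (addrAC S) subrr add0r.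
move: (T - Y) ZS => Z ZS.
rewrite mulrBr mulr1 [S * (_ * Z)]mulrA SAW mulrBl mul1r bop_scaleAl addrAC ZS.
by rewrite [RHS]scalerBr [k *: (k^-1 *: _)]scalerA mulfV// scale1r scalerN addrC.
Qed.

(** In [resolvent_diff] the projection meets the factor [T - t] and yields [b - a]; [K ^+ 2] bounds
    the scalar and the rest bounds the bracket. The constant does not involve [s], so the estimate
    can be integrated. *)
Lemma local_kernel_bound (r m C K : R) s (t a b : R) :
  s != t%:A -> invertible (Qop s T) -> a <= t -> t <= b ->
  `|bop_inv (Qop s T)| <= r -> `|s| <= m -> `|(s - t%:A)^-1| <= K ->
  (forall q, `|L q| <= C * `|q|) -> 0 <= C ->
  `|E `]a, b]%classic * (left_S_resolvent L s T - L (s - t%:A)^-1)| <=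
  K ^+ 2 * (r * (`|T| + (`|t| + 2 * m)) * (`|T| + C * m) + 1) * (b - a).
Proof.
move=> st is_ at_ tb Ar sm sK hC C0.
have ba : 0 <= b - a by rewrite subr_ge0 (le_trans at_).
have r0 : 0 <= r by rewrite (le_trans _ Ar).
have m0 : 0 <= m by rewrite (le_trans _ sm).
have K0 : 0 <= K by rewrite (le_trans _ sK).
rewrite resolvent_diff// bop_scaleAr mulrA normrZ -[leRHS]mulrA ler_pM//.
  rewrite normfV normrX normr_id -exprVn -qnormV ?subr_eq0//.
  by rewrite ler_pXn2r ?nnegrE.
rewrite (le_trans (bop_normM _ _))// mulrC ler_pM//; last exact: spectral_local_norm.
rewrite (le_trans (ler_normB _ _))// lerD ?bop_norm1//.
rewrite (le_trans (bop_normM _ _))// ler_pM//.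
  rewrite (le_trans (bop_normM _ _))// ler_pM// (le_trans (ler_normD _ _))// lerD2l.
  rewrite normrZ (@le_trans _ _ (`|t - 2 * qre s|))//.
    by rewrite ler_piMr// bop_norm1.
  rewrite (le_trans (ler_normB _ _))// lerD2l normrM ger0_norm// ler_wpM2l//.
  by have [h _ _ _] := qcomp_le_norm s; rewrite (le_trans h).
rewrite (le_trans (ler_normB _ _))// lerD2l (le_trans (hC _))// ler_wpM2l//.
by rewrite qnorm_conj.
Qed.

End LocalEstimate.

(** * From local estimates on the integrals to an operator identity *)

Section RieszProjection.
Context {R : realType} {H : qhilbertType R} (T : bop H) (E : pvm H).
Hypothesis hT : selfadjoint T.
Hypothesis hE : is_spectral_measure T E.
Variable L : quat R -> bop H.
Hypothesis hL : left_scalar_mult L.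
Variables (I : quat R).
Hypothesis hI : imag_unit I.

(** As [L] is multiplicative, applying it to the Cauchy form leaves the same right factor
    [L (- I * ds)] as in the resolvent form, and the integrands differ only by the kernels. The
    constant is the kernel bound times the bound [C] of [L] and the variation of [g]. *)
Lemma curve_local_estimate (g : R -> quat R) (t : R) :
  jordan_curve g -> rectifiable g ->
  (forall s, 0 <= s <= 1 -> invertible (Qop (g s) T)) -> real_spectrum T t ->
  exists2 C, 0 <= C & forall a b, a <= t -> t <= b ->
    `|E `]a, b]%classic *
        line_integral g (fun s ds => left_S_resolvent L s T * L (- I * ds)) -
      E `]a, b]%classic *
        L (line_integral g (fun s ds => (s - t%:A)^-1 * (- I * ds)))| <= C * (b - a).
Proof.
move=> [gc _ _] gr gT st.
have gt s : 0 <= s <= 1 -> g s != t%:A.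
  by move=> s01; apply/eqP => e; apply: st; rewrite -e; exact: gT.
have [r r0 hr] := resolvent_bounded gc gT; have [m hm] := curve_bounded gc.
have [K hK] := curve_inv_bounded gc gt; have [C C0 hC] := lsm_bounded hL.
have z01 : (0 : R) <= 0 <= (1 : R) by rewrite lexx ler01.
have m0 : 0 <= m by rewrite (le_trans _ (hm 0 z01)).
have K0 : 0 <= K by rewrite (le_trans _ (hK 0 z01)).
have [M gM] := gr.
have M0 : 0 <= M.
  have [n [u [tag [su _]]]] := tagged_exists (@ltr01 R).
  by apply: le_trans (gM _ _ su); apply: sumr_ge0.
set D := K ^+ 2 * (r * (`|T| + (`|t| + 2 * m)) * (`|T| + C * m) + 1).
have D0 : 0 <= D by rewrite /D !(addr_ge0, mulr_ge0)// exprn_ge0.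
exists (D * C * M) => [|a b at_ tb]; first by rewrite mulr_ge0// mulr_ge0.
have ba : 0 <= b - a by rewrite subr_ge0 (le_trans at_).
have mB : measurable (`]a, b]%classic : set (measurableTypeR R)) by exact: measurable_ocitv.
have EB := pvm_norm E mB; set P := E `]a, b]%classic in EB *.
have -> : D * C * M * (b - a) = D * (b - a) * C * M by ring.
apply: (@line_integral_close _ _ _ _ _
  (fun s ds => left_S_resolvent L s T * L (- I * ds))
  (fun s ds => (s - t%:A)^-1 * (- I * ds)) _ _ (fun A : bop H => P * A)
  (fun q => P * L q) (1 + C) _ _ gM) => //.
- by move=> x y; rewrite mulrDr.
- by move=> x y; rewrite (lsmD hL) mulrDr.
- move=> x; rewrite (le_trans (bop_normM _ _))// ler_wpM2r// (le_trans EB)//.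
  by rewrite lerDl.
- move=> x; rewrite (le_trans (bop_normM _ _))//.
  apply: (@le_trans _ _ (1 * (C * `|x|))); first exact: ler_pM.
  by rewrite mul1r ler_wpM2r// lerDr.
- move=> s h s01; rewrite (lsmM hL _^-1) -mulrBr -mulrBl mulrA.
  rewrite (le_trans (bop_normM _ _))// -[leRHS]mulrA ler_pM//; last exact: norm_lsm_turn.
  apply: (local_kernel_bound hT hE hL (gt s s01) (gT s s01)) => //.
  + exact: hr.
  + exact: hm.
  + exact: hK.
- by rewrite mulr_ge0// mulr_ge0.
- exact: resolvent_line_integral.
- exact: cauchy_line_integral.
Qed.

Lemma riesz_local_estimate n (G : 'I_n -> R -> quat R) (t : R) (c : R) :
  (forall i, jordan_curve (G i) /\ rectifiable (G i)) ->
  (forall i s, 0 <= s <= 1 -> invertible (Qop (G i s) T)) -> real_spectrum T t ->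
  winding I G t%:A = c%:A ->
  exists2 C, 0 <= C & forall a b, a <= t -> t <= b ->
    `|E `]a, b]%classic * (riesz_projection L T I G - c *: (1 : bop H))| <= C * (b - a).
Proof.
move=> hG GT st wG.
have /choice[C hC] : forall i, exists C, 0 <= C /\ forall a b, a <= t -> t <= b ->
    `|E `]a, b]%classic *
        line_integral (G i) (fun s ds => left_S_resolvent L s T * L (- I * ds)) -
      E `]a, b]%classic *
        L (line_integral (G i) (fun s ds => (s - t%:A)^-1 * (- I * ds)))| <= C * (b - a).
  move=> i; have [h1 h2] := hG i.
  by have [C C0 hC] := curve_local_estimate h1 h2 (GT i) st; exists C.
have pi2 : 0 <= (2 * pi)^-1 :> R by rewrite invr_ge0 mulr_ge0// pi_ge0.
exists ((2 * pi)^-1 * \sum_i C i) => [|a b at_ tb].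
  by rewrite mulr_ge0// sumr_ge0// => i _; have [] := hC i.
have L0 : L 0 = 0 by apply: (addrI (L 0)); rewrite -(lsmD hL) !addr0.
have -> : c *: (1 : bop H) = L (winding I G t%:A) by rewrite wG (lsm_real hL).
rewrite /riesz_projection /winding /cycle_integral (lsmZ hL) -scalerBr bop_scaleAr.
rewrite normrZ ger0_norm// -mulrA ler_wpM2l//.
rewrite (big_morph L (lsmD hL) L0) -sumrB mulr_sumr mulr_suml.
rewrite (le_trans (ler_norm_sum _ _ _))// ler_sum// => i _.
by rewrite mulrBr; have [_] := hC i; apply.
Qed.

(* The local bound is quadratic in the length of the interval, so it sums to 0
   over fine partitions although [A] need not commute with [E]. *)
Lemma bop_eq0_local (A : bop H) :
  (forall t, exists2 d, 0 < d & exists2 C, 0 <= C & forall a b, a <= t -> t <= b ->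
    b - a < d -> `|E `]a, b]%classic * A| <= C * (b - a)) -> A = 0.
Proof.
move=> loc; apply: bop_ext => x; rewrite bopE; apply: (pvm_eq0 (E := E)) => a b ab.
suff h : forall e, 0 < e -> `|E `]a, b]%classic (A x)| ^+ 2 <= e * (b - a).
  apply/eqP; rewrite -normr_eq0 -sqrf_eq0 eq_le sqr_ge0 andbT.
  apply/ler_addgt0Pr => e e0; rewrite add0r.
  have ba : 0 < b - a + 1 by rewrite ltr_wpDl// subr_ge0.
  rewrite (le_trans (h _ (divr_gt0 e0 ba)))//.
  by rewrite mulrAC ler_pdivrMr// ler_pM2l// lerDl.
move=> e e0; pose P (a b : R) := `|E `]a, b]%classic (A x)| ^+ 2 <= e * (b - a).
apply: (@cousin _ P) => // [u v w uv vw|t _].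
  rewrite /P => h1 h2.
  have -> : `]u, w]%classic = `]u, v]%classic `|` `]v, w]%classic.
    by rewrite -itv_bndbnd_setU// bnd_simp.
  rewrite pvm_sqr_normU; [|exact: measurable_ocitv|exact: measurable_ocitv|].
    have -> : w - u = (v - u) + (w - v) by rewrite [RHS]addrC addrA subrK.
    by rewrite mulrDr lerD.
  apply/seteqP; split => // z [] /=; rewrite !in_itv /= => /andP[_ h3] /andP[h4 _].
  by move: (lt_le_trans h4 h3); rewrite ltxx.
have [d d0 [C C0 hC]] := loc t.
(* Of the two factors [v - u] in the squared bound, one is kept as the length and the other, less
   than [e / k], absorbs the constant and leaves [e]. *)
pose k := (C * `|x|) ^+ 2 + 1.
have k0 : 0 < k by rewrite /k ltr_wpDl// sqr_ge0.
exists (Num.min d (e / k)) => [|u v ut tv]; first by rewrite lt_min d0 divr_gt0.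
rewrite lt_min => /andP[vd vk].
have vu : 0 <= v - u by rewrite subr_ge0 (le_trans ut).
rewrite /P (@le_trans _ _ ((C * (v - u) * `|x|) ^+ 2))//.
  rewrite ler_pXn2r ?nnegrE// ?mulr_ge0//.
  by rewrite (le_trans (bop_norm_ub (E `]u, v]%classic * A) x))// ler_wpM2r// hC.
rewrite mulrAC exprMn [X in _ * X]expr2 mulrA ler_wpM2r//.
rewrite (@le_trans _ _ (k * (e / k)))//; last by rewrite mulrC divfK// gt_eqF.
by rewrite ler_pM// ?sqr_ge0// ?lerDl// ltW.
Qed.

End RieszProjection.

(** * Topology of the isolated part and of its domain *)

Section RieszDomain.
Context {R : realType} {H : qhilbertType R} (T : bop H).
Variables (Delta U : set (quat R)).
Hypothesis hDelta : isolated_part T Delta.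
Hypothesis hU : riesz_domain T Delta U.

(** A spectral point in the closure of [U] lies in [Delta], hence in the open set [U], and so cannot
    adhere to the complement of [U] in the slice. *)
Lemma boundary_resolvent (I s : quat R) : slice_boundary I U s -> invertible (Qop s T).
Proof.
move=> [s1 s2]; apply: contrapT => ns.
have [_ axU DU clU _] := hU; have [_ oU] := axU.
have : Delta s by rewrite -clU; split => //; apply: closure_subset s1 => z [].
by move=> /DU Us; have [z [[_ nz] /nz]] := s2 U (open_nbhs_nbhs (conj oU Us)).
Qed.

Lemma continuous_real_embed : continuous (fun t : R => t%:A : quat R).
Proof.
move=> t; apply/cvgrPdist_lt => e e0; exists e => //= s /=.
by rewrite -scalerBl qnormr.
Qed.

(** Membership in [Delta] is locally constant on the spectrum: relative openness serves at a point
    of [Delta], relative closedness at any other. *)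
Lemma isolated_near (t : R) : real_spectrum T t ->
  exists2 d, 0 < d & forall s, real_spectrum T s -> `|s - t| < d ->
    (Delta s%:A <-> Delta t%:A).
Proof.
move=> st; have [_ _ subD [ O oO DO] [C cC DC]] := hDelta.
have ball_of (W : set (quat R)) : open W -> W t%:A ->
    exists2 d, 0 < d & forall s : R, `|s - t| < d -> W s%:A.
  move=> oW Wt; have : nbhs t ((fun t : R => t%:A : quat R) @^-1` W).
    by apply: continuous_real_embed; exact: open_nbhs_nbhs.
  move=> /nbhs_ballP[d /= d0 hd]; exists d => // s sd.
  by apply: hd; rewrite -ball_normE /= distrC.
have [Dt|nDt] := pselect (Delta t%:A).
  have Ot : O t%:A by move: Dt; rewrite DO => -[].
  have [d d0 hd] := ball_of O oO Ot.
  exists d => // s ss sd; split=> // _.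
  by rewrite DO; split; [exact: hd|].
have nCt : (~` C) t%:A by move=> Ct; apply: nDt; rewrite DC.
have [d d0 hd] := ball_of _ (closed_openC cC) nCt.
exists d => // s ss sd; split=> // Ds; exfalso.
by apply: (hd s sd); move: Ds; rewrite DC => -[].
Qed.

Lemma measurable_isolated :
  measurable ([set t : R | Delta t%:A] : set (measurableTypeR R)).
Proof.
have [_ _ _ [ O oO DO] _] := hDelta.
have -> : [set t : R | Delta t%:A] =
    (fun t : R => t%:A : quat R) @^-1` O `&` real_spectrum T by rewrite DO.
apply: measurableI.
  apply: open_measurableTypeR; apply: open_comp oO => t _.
  exact: continuous_real_embed.
rewrite -[real_spectrum T]setCK; apply: measurableC.
exact: measurable_resolvent_set.
Qed.

End RieszDomain.


Unset Implicit Arguments.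

Theorem theorem6p2 (R : realType) (H : qhilbertType R) (Hsep : separable H)
    (L : quat R -> bop H) (hL : left_scalar_mult L)
    (T : bop H) (hT : selfadjoint T)
    (E : pvm H) (hE : is_spectral_measure T E)
    (Delta : set (quat R)) (hDelta : isolated_part T Delta)
    (U : set (quat R)) (hU : riesz_domain T Delta U)
    (I : quat R) (hI : imag_unit I)
    (n : nat) (G : 'I_n -> R -> quat R)
    (hG : positively_oriented_boundary I U G) :
  riesz_projection L T I G = E [set t : R | Delta t%:A] /\
  orthogonal_projection (riesz_projection L T I G).
Proof.
have mD := measurable_isolated hDelta.
suff -> : riesz_projection L T I G = E [set t : R | Delta t%:A].
  by split => //; exact: pvm_proj.
have [hJ bG win1 win0] := hG.
have GT i s : 0 <= s <= 1 -> invertible (Qop (G i s) T).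
  move=> s01; apply: (boundary_resolvent hU (I := I)); rewrite bG.
  by exists i => //; exists s => //=; rewrite in_itv.
apply/eqP; rewrite -subr_eq0; apply/eqP; apply: (@bop_eq0_local _ _ E) => t.
have [st|nst] := pselect (real_spectrum T t); last first.
  have [d d0 hd] := pvm_off_spectrum hT hE nst; exists d => //.
  by exists 0 => // a b at_ tb ba; rewrite hd// mul0r mul0r normr0.
have tI : slice I (t%:A : quat R) by exists t, 0; rewrite scale0r addr0.
have [d d0 hd] := isolated_near hDelta st; exists d => //.
pose c : R := (`[< Delta t%:A >])%:R.
have wc : winding I G t%:A = c%:A.
  rewrite /c; case: asboolP => Dt; rewrite ?scale1r ?scale0r.
    by apply: win1; split=> //; case: hU => _ _ + _ _; apply.
  (* The spectral point [t] would belong to [Delta] if it were in the closure of [U], so it is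
     exterior and the winding number there is 0. *)
  apply: win0; split=> // /(closure_subset (@subIsetl _ U (slice I))) clt.
  by apply: Dt; case: hU => _ _ _ <- _; split.
have [C C0 hC] := riesz_local_estimate hT hE hL hI hJ GT st wc.
exists C => // a b at_ tb ba.
have mB : measurable (`]a, b]%classic : set (measurableTypeR R)) by exact: measurable_ocitv.
(* On this short interval the spectrum lies entirely inside or entirely outside [Delta], and the
   resolvent set is null for [E]; hence [E(Delta)] acts there as the same scalar [c] that the
   winding number gives for the Riesz projection. *)
suff Ec : E `]a, b]%classic * E [set t : R | Delta t%:A] =
    E `]a, b]%classic * (c *: (1 : bop H)).
  by rewrite mulrBr Ec -mulrBr; exact: hC.
have near s : `]a, b]%classic s -> `|s - t| < d.
  by rewrite /= in_itv /= => /andP[s1 s2]; rewrite ltr_norml; apply/andP; split; lra.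
apply: bop_ext => x; rewrite bop_scaleAr mulr1 !bopE pvm_capE// /c.
case: asboolP => Dt; rewrite ?scale1r ?scale0r.
  set B := `]a, b]%classic : set (measurableTypeR R).
  set D := [set t : R | Delta t%:A] : set (measurableTypeR R).
  have nul : E (B `&` ~` D) x = 0.
    apply: (@pvm_null_bigcup _ _ E (fun=> ~` real_spectrum T)) => [_||s [Bs nDs]|_].
    - by have h := @measurable_resolvent_set R H T; exact: h.
    - by apply: measurableI => //; exact: measurableC.
    - by exists 0%N => // ss; apply: nDs; apply/(hd s ss (near s Bs)).
    - exact: pvm_resolvent_set.
  have -> : B = (B `&` D) `|` (B `&` ~` D) by rewrite -setIUr setUv setIT.
  rewrite pvmU ?nul ?addr0//.
  - by rewrite -setIUr setUv setIT.
  - exact: measurableI.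
  - by apply: measurableI => //; exact: measurableC.
  - by rewrite setIACA setICr setI0.
rewrite (_ : _ `&` _ = set0) ?pvm0//; apply/seteqP; split=> // s [Bs Ds]; apply: Dt.
have ss : real_spectrum T s by case: hDelta => _ _ + _ _; apply.
by apply/(hd s ss (near s Bs)).
Qed.
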